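(* There exists a mapping $f \in C^{2}([0,1]\times\mathbb{R};\mathbb{R})$ such that, almost surely, $X_t = f(t,B_t)$ for all $t\in[0,1]$, if and only if $(a'\sigma - a\sigma')(x)=0$ for all $x\in\mathbb{R}$.
   Context: Let $H\in(1/2,1)$ and let $B=(B_t)_{t\in[0,1]}$ be a fractional Brownian motion with Hurst parameter $H$ on a complete probability space $(\Omega,\mathcal{F},P)$, i.e. a continuous centered Gaussian process with covariance $\frac12(s^{2H}+t^{2H}-|t-s|^{2H})$. Let $x_0\in\mathbb{R}$, $a\in C^2(\mathbb{R})$, $\sigma\in C^3(\mathbb{R})$ be real-valued functions with bounded derivatives (up to order 2 and 3 respectively), such that $a$ and $\sigma$ are bounded and $\inf_{x\in\mathbb{R}}\sigma(x)>0$. Let $X=(X_t)_{t\in[0,1]}$ be the unique solution of $X_t = x_0+\int_0^t a(X_\tau)\,d\tau+\int_0^t\sigma(X_\tau)\,dB_\tau$, $t\in[0,1]$, where the integral with respect to $B$ is a pathwise Riemann–Stieltjes integral. *)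

(* Defs.v *)
From HB Require Import structures.
From mathcomp Require Import all_boot all_order all_algebra.
From mathcomp Require Import all_classical all_reals all_analysis.

Set Implicit Arguments.
Unset Strict Implicit.
Unset Printing Implicit Defensive.

Import Order.TTheory GRing.Theory Num.Theory.
Import numFieldNormedType.Exports.

Local Open Scope classical_set_scope.
Local Open Scope ring_scope.

(** Laws of the form [normal_prob m 0] are not point masses in the library (the
    density degenerates to that of the uniform law on [0, 1]), so the degenerate
    Gaussian laws have to be listed separately. *)
Definition gaussian_rv (R : realType) (d : measure_display)
    (T : measurableType d) (P : probability T R) (Y : T -> R) : Prop :=
  measurable_fun setT Y /\
  ((exists m s : R, s != 0 /\
      forall A : set R, measurable A -> P (Y @^-1` A) = normal_prob m s A) \/
   (exists m : R,
      forall A : set R, measurable A -> P (Y @^-1` A) = \d_m A)).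

(** Processes on [0, 1] are families indexed by the whole of [R] of which only
    the members with index in [0, 1] are ever constrained or used. *)
Definition gaussian_process (R : realType) (d : measure_display)
    (T : measurableType d) (P : probability T R)
    (B : R -> {RV P >-> R}) : Prop :=
  forall (n : nat) (t c : 'I_n -> R), (forall i, t i \in `[0, 1]) ->
    gaussian_rv P (fun w => \sum_(i < n) c i * B (t i) w).

Definition fractional_brownian_motion (R : realType) (d : measure_display)
    (T : measurableType d) (P : probability T R) (H : R)
    (B : R -> {RV P >-> R}) : Prop :=
  [/\ gaussian_process B,
      forall t : R, t \in `[0, 1] -> ('E_P[B t] = 0)%E,
      forall s t : R, s \in `[0, 1] -> t \in `[0, 1] ->
        covariance P (B s) (B t) =
        (2^-1 * (s `^ (2 * H) + t `^ (2 * H) - `|t - s| `^ (2 * H)))%:E &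
      forall w, {within `[0, 1], continuous (fun t : R => B t w)}].

Definition class_C (R : realType) (k : nat) (g : R -> R) : Prop :=
  (forall j, (j < k)%N -> forall x, derivable (derive1n j g) x 1) /\
  continuous (derive1n k g).

Definition bounded_derivatives (R : realType) (k : nat) (g : R -> R) : Prop :=
  forall j, (0 < j <= k)%N -> bounded_fun (derive1n j g).

(** [I] is the Riemann-Stieltjes integral of [g] against [h] over [[a, b]]: the
    limit, as the mesh tends to 0, of the sums over arbitrarily tagged
    partitions.  The points of a partition are [a] followed by the sequence [s];
    for [a = b] the only partition is the empty one, and the integral is 0. *)
Definition is_RS_integral (R : realType) (g h : R -> R) (a b I : R) : Prop :=
  forall e : R, 0 < e -> exists2 delta : R, 0 < delta &
    forall (s : seq R) (xi : nat -> R),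
      let p := nth b (a :: s) in
      itv_partition a b s ->
      (forall i, (i < size s)%N -> p i.+1 - p i < delta) ->
      (forall i, (i < size s)%N -> p i <= xi i <= p i.+1) ->
      `| \sum_(0 <= i < size s) g (xi i) * (h (p i.+1) - h (p i)) - I | < e.

Definition is_solution (R : realType) (d : measure_display)
    (T : measurableType d) (P : probability T R) (B : R -> {RV P >-> R})
    (x0 : R) (a sigma : R -> R) (X : R -> {RV P >-> R}) : Prop :=
  {ae P, forall w, {within `[0, 1], continuous (fun t : R => X t w)} /\
    forall t : R, t \in `[0, 1] -> exists2 I : R,
      is_RS_integral (fun s => sigma (X s w)) (fun s => B s w) 0 t I &
      X t w = x0 + \int[lebesgue_measure]_(s in `[0, t]) a (X s w) + I}.

(** Functions of class C^k on the closed strip [0, 1] x R: all iterated partial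
    derivatives up to order [k] exist and are jointly continuous on the strip,
    the time derivatives at the end points 0 and 1 being one-sided.  Values
    outside the strip are irrelevant. *)
Fixpoint class_C_strip (R : realType) (k : nat) (f : R * R -> R) : Prop :=
  {within `[0, 1]%classic `*` setT, continuous f} /\
  if k is k'.+1 then
    exists ft fx : R * R -> R,
      [/\ forall t x : R, t \in `[0, 1] ->
            (f (s, x) - f (t, x)) / (s - t)
              @[s --> within `[0, 1] t^'] --> ft (t, x),
          forall t x : R, t \in `[0, 1] ->
            is_derive x (1 : R) (fun y : R => f (t, y)) (fx (t, x)),
          class_C_strip k' ft & class_C_strip k' fx]
  else True.

(* Main.v *)
(** Let [Lam] be an antiderivative of [1 / sigma].  The increments of [B] over
    uniform partitions have quadratic variation tending to 0 because [2H > 1],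
    so the first order chain rule holds and, almost surely,
      Lam (X t) = Lam x0 + B t + \int_0^t (a / sigma) (X s) ds.
    If [a = kappa * sigma], this reads X t = Lam^-1 (Lam x0 + kappa t + B t).
    Conversely, if X t = f (t, B t), put phi (t, y) = Lam (f (t, y)) - y, so
    that t |-> phi (t, B t) is Lipschitz.  Where the space derivative of [phi]
    does not vanish, the path of [B] would be Lipschitz at a given time, an
    event of probability 0, whereas [B t] visits every interval with positive
    probability.  Hence phi (t, y) depends on [t] only, and its time derivative
    (a / sigma) (f (t, B t)) is deterministic; since f (t, _) is onto, a / sigma
    is constant. *)
Require Import Defs.
From HB Require Import structures.
From mathcomp Require Import all_boot all_order all_algebra.
From mathcomp Require Import all_classical all_reals all_analysis.
From mathcomp Require Import measurable_realfun ring lra.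

Set Implicit Arguments.
Unset Strict Implicit.
Unset Printing Implicit Defensive.

Import Order.TTheory GRing.Theory Num.Theory.
Import numFieldNormedType.Exports.

Local Open Scope classical_set_scope.
Local Open Scope ring_scope.

(** The chain rule is the delicate point. [is_solution] gives a continuous path and a limit of sums
    for each end point, so no Hoelder exponent of [X], hence no Young estimate, is at hand. The
    Saks-Henstock lemma fills the gap: along a fine partition the errors
    [sigma (X s) * (B t - B s) - (I t - I s)] are small in absolute sum, so the squared increments
    of [X] are controlled by those of [B]. In the converse, Gaussian laws enter through two facts: a
    small ball bound, which makes Lipschitz behaviour at a given time improbable, and positive mass
    of intervals, which meets every almost sure event and so provides a single path on which the
    argument is deterministic. The law comes with an unknown scale [s]; the crude bound of the
    variance by [16 * s ^+ 2] suffices to control its density. *)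

(** * Riemann-Stieltjes sums *)

(** An inductive form of the sums in [is_RS_integral], whose point is that two
    sums over adjacent intervals can be concatenated. *)
Inductive tagged_sum {R : realType} (g h : R -> R) (delta : R) :
    R -> R -> R -> Prop :=
| tagged_sum_nil a : tagged_sum g h delta a a 0
| tagged_sum_cons a c b xi v : a < c -> c - a < delta -> a <= xi <= c ->
    tagged_sum g h delta c b v ->
    tagged_sum g h delta a b (g xi * (h c - h a) + v).

Section tagged_sums.
Context {R : realType}.
Implicit Types (g h : R -> R) (a b c delta v : R).

Lemma tagged_sum_cat g h delta a b c v w : tagged_sum g h delta a b v ->
  tagged_sum g h delta b c w -> tagged_sum g h delta a c (v + w).
Proof.
elim=> [x|x y z xi u xy yd xiI _ IH] bc; first by rewrite add0r.
by rewrite -addrA; apply: tagged_sum_cons => //; exact: IH.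
Qed.

Lemma tagged_sum1 g h delta a b xi : a < b -> b - a < delta -> a <= xi <= b ->
  tagged_sum g h delta a b (g xi * (h b - h a)).
Proof.
move=> ab abd xiI; rewrite -[X in tagged_sum _ _ _ _ _ X]addr0.
by apply: tagged_sum_cons => //; exact: tagged_sum_nil.
Qed.

Lemma tagged_sum_mono g h delta delta' a b v : delta <= delta' ->
  tagged_sum g h delta a b v -> tagged_sum g h delta' a b v.
Proof.
move=> dd; elim=> [x|x y z xi u xy yd xiI _ IH]; first exact: tagged_sum_nil.
by apply: tagged_sum_cons => //; exact: lt_le_trans dd.
Qed.

Lemma tagged_sum_exists g h delta a b : 0 < delta -> a <= b ->
  exists v, tagged_sum g h delta a b v.
Proof.
move=> d0 ab.
(* Steps of half the allowed length, since the mesh condition is strict. *)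
have d20 : 0 < delta / 2 by rewrite divr_gt0.
have [n] : exists n : nat, b - a <= n%:R * (delta / 2).
  exists (Num.bound ((b - a) / (delta / 2))).
  rewrite -ler_pdivrMr//; apply/ltW/archi_boundP.
  by rewrite divr_ge0 ?subr_ge0// ltW.
elim: n a ab => [|n IH] a ab.
  rewrite mul0r subr_le0 => ba; exists 0.
  have -> : b = a by apply/eqP; rewrite eq_le ab ba.
  exact: tagged_sum_nil.
move=> nab; have [bad|bad] := ltP (b - a) delta.
  have [ab'|ba] := ltP a b.
    by eexists; apply: (@tagged_sum1 _ _ _ _ _ a) => //; rewrite lexx ltW.
  exists 0; have -> : b = a by apply/eqP; rewrite eq_le ab ba.
  exact: tagged_sum_nil.
have [||v] := IH (a + delta / 2).
- lra.
- by move: nab; rewrite -natr1 mulrDl mul1r; lra.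
- move=> ts; eexists; apply: (@tagged_sum_cons _ _ _ _ _ (a + delta / 2) _ a) ts.
  + lra.
  + lra.
  + by rewrite lexx/=; lra.
Qed.

Lemma tagged_sum_big g h delta n (p z : nat -> R) :
  (forall i, (i < n)%N -> tagged_sum g h delta (p i) (p i.+1) (z i)) ->
  tagged_sum g h delta (p 0%N) (p n) (\sum_(0 <= i < n) z i).
Proof.
elim: n => [|n IH] pz; first by rewrite big_nil; exact: tagged_sum_nil.
rewrite big_nat_recr//=; apply: (@tagged_sum_cat _ _ _ _ (p n)); last exact: pz.
by apply: IH => i ni; apply: pz; rewrite ltnS ltnW.
Qed.

Lemma tagged_sum_partition g h delta a b v : tagged_sum g h delta a b v ->
  exists (s : seq R) (xi : nat -> R),
    let p := nth b (a :: s) in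
    [/\ itv_partition a b s,
        forall i, (i < size s)%N -> p i.+1 - p i < delta,
        forall i, (i < size s)%N -> p i <= xi i <= p i.+1 &
        v = \sum_(0 <= i < size s) g (xi i) * (h (p i.+1) - h (p i))].
Proof.
elim=> [x|x y z t u xy yd xiI _ [s [xi [[ps ls] msh tag ->]]]].
  by exists [::], (fun=> 0); split=> //=; rewrite big_nil.
exists (y :: s), (fun i => if i is j.+1 then xi j else t); split.
- by split; rewrite //= xy.
- by case=> [|i]//=; rewrite ltnS; exact: msh.
- by case=> [|i]//=; rewrite ltnS; exact: tag.
- by rewrite /= big_nat_recl.
Qed.

Lemma is_RS_integral_tagged_sum g h a b I : is_RS_integral g h a b I ->
  forall e : R, 0 < e -> exists2 delta : R, 0 < delta &
    forall v, tagged_sum g h delta a b v -> `|v - I| < e.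
Proof.
move=> gI e /gI[delta d0 H]; exists delta => // v.
by move=> /tagged_sum_partition[s [xi [sp msh tag ->]]]; exact: H.
Qed.

(** Prolong a fine sum over [[0, s]] by a fine sum over [[s, t]]: both the short and the long sum
    are close to their limits, so the added part is close to the difference. *)
Lemma tagged_sum_increment g h (T : R) (I : R -> R) :
  (forall t : R, 0 <= t <= T -> forall e : R, 0 < e ->
    exists2 delta : R, 0 < delta &
    forall v, tagged_sum g h delta 0 t v -> `|v - I t| < e) ->
  forall delta e s t : R, 0 < delta -> 0 < e -> 0 <= s -> s <= t -> t <= T ->
  exists v, tagged_sum g h delta s t v /\ `|v - (I t - I s)| < e.
Proof.
move=> gI delta e s t d0 e0 s0 st tT.
have e20 : 0 < e / 2 by rewrite divr_gt0.
have [|d1 d10 H1] := gI s _ _ e20; first by rewrite s0 (le_trans st).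
have [|d2 d20 H2] := gI t _ _ e20; first by rewrite (le_trans s0).
have mp : 0 < Num.min delta (Num.min d1 d2) by rewrite !lt_min d0 d10.
have m1 : Num.min delta (Num.min d1 d2) <= d1.
  by rewrite !ge_min lexx orbT.
have m2 : Num.min delta (Num.min d1 d2) <= d2.
  by rewrite !ge_min lexx !orbT.
have m0 : Num.min delta (Num.min d1 d2) <= delta by rewrite !ge_min lexx.
have [u us] := tagged_sum_exists g h mp s0.
have [v vs] := tagged_sum_exists g h mp st.
exists v; split; first exact: tagged_sum_mono vs.
have /H1 := tagged_sum_mono m1 us.
have /H2 := tagged_sum_mono m2 (tagged_sum_cat us vs).
rewrite !ltr_norml => /andP[? ?] /andP[? ?]; apply/andP; split; lra.
Qed.

(* Saks-Henstock: since the pieces of a fine partition may be replaced one by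
   one by much finer partitions, the signs of the errors can be separated. *)
Lemma saks_henstock g h (T : R) (I : R -> R) : 0 <= T ->
  (forall t : R, 0 <= t <= T -> forall e : R, 0 < e ->
    exists2 delta : R, 0 < delta &
    forall v, tagged_sum g h delta 0 t v -> `|v - I t| < e) ->
  forall e : R, 0 < e -> exists2 delta : R, 0 < delta &
    forall n (p : nat -> R), p 0%N = 0 -> p n = T ->
    (forall i, 0 <= p i) -> (forall i, (i <= n)%N -> p i <= T) ->
    (forall i, p i < p i.+1) ->
    (forall i, p i.+1 - p i < delta) ->
    \sum_(0 <= i < n) `|g (p i) * (h (p i.+1) - h (p i))
                        - (I (p i.+1) - I (p i))| < e.
Proof.
move=> T0 gI e e0; have e40 : 0 < e / 4 by rewrite divr_gt0.
have [|delta d0 H] := gI T _ _ e40; first by rewrite T0 lexx.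
exists delta => // n p p0 pn pge0 pT pS pd.
(* The [n] replacement sums together cost at most [e / 4]; [n.+1] keeps [eta] defined when
   [n = 0]. *)
pose eta := e / 4 / n.+1%:R.
have eta0 : 0 < eta by rewrite divr_gt0.
have /choice[v vP] : forall i, exists v, (i < n)%N ->
    tagged_sum g h delta (p i) (p i.+1) v /\
    `|v - (I (p i.+1) - I (p i))| < eta.
  move=> i; have [ni|] := ltnP i n; last by exists 0.
  have [v vP] := tagged_sum_increment gI d0 eta0 (pge0 i) (ltW (pS i)) (pT _ ni).
  by exists v.
pose u i := g (p i) * (h (p i.+1) - h (p i)).
have uP i : tagged_sum g h delta (p i) (p i.+1) (u i).
  by apply: tagged_sum1 => //; rewrite lexx ltW.
(* Choosing the larger, or the smaller, of [u i] and [v i] on every piece still gives a fine sum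
   over [[0, T]]. The two totals are both within [e / 4] of [I T], and their difference is the sum
   of all [|u i - v i|]. *)
have maxP i : (i < n)%N ->
    tagged_sum g h delta (p i) (p i.+1) (Num.max (u i) (v i)).
  by move=> ni; rewrite maxEle; case: ifP => _ //; exact: (vP _ ni).1.
have minP i : (i < n)%N ->
    tagged_sum g h delta (p i) (p i.+1) (Num.min (u i) (v i)).
  by move=> ni; rewrite minEle; case: ifP => _ //; exact: (vP _ ni).1.
have := tagged_sum_big maxP; rewrite p0 pn => /H.
have := tagged_sum_big minP; rewrite p0 pn => /H.
rewrite !ltr_norml => /andP[h1 h2] /andP[h3 h4].
have : \sum_(0 <= i < n) `|u i - (I (p i.+1) - I (p i))| <=
  \sum_(0 <= i < n) (Num.max (u i) (v i) - Num.min (u i) (v i) + eta).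
  rewrite big_nat_cond [leRHS]big_nat_cond; apply: ler_sum => i.
  rewrite andbT => /andP[_ /vP[_]]; rewrite ltr_norml => /andP[k1 k2].
  rewrite ler_norml; have [uv|uv] := leP (u i) (v i); lra.
move=> /le_lt_trans; apply.
rewrite big_split/= sumrB sumr_const_nat subn0 -mulr_natl.
have : n%:R * eta <= e / 4.
  rewrite /eta mulrCA ler_piMr ?(ltW e40)// ler_pdivrMr// mul1r ler_nat//.
lra.
Qed.

End tagged_sums.


(** * Antiderivatives and paths on [[0, 1]] *)

Section primitives.
Context {R : realType}.
Implicit Types (f g F G : R -> R) (a b c x y : R).

Lemma is_derive_continuous F f :
  (forall x, is_derive x (1 : R) F (f x)) -> continuous F.
Proof.
move=> dF x; apply: differentiable_continuous.
by apply/derivable1_diffP; have [] := dF x.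
Qed.

Lemma MVT_is_derive F f a b : (forall x, is_derive x (1 : R) F (f x)) ->
  a <= b -> exists2 c, a <= c <= b & F b - F a = f c * (b - a).
Proof.
move=> dF ab; have cF : {within `[a, b], continuous F}.
  by apply: continuous_subspaceT; exact: is_derive_continuous dF.
have [c + ->] := MVT_segment ab (fun x _ => dF x) cF.
by rewrite in_itv/= => cab; exists c.
Qed.

Lemma MVT_dist F f x y : (forall u, is_derive u (1 : R) F (f u)) ->
  exists c, `|c - x| <= `|y - x| /\ F y - F x = f c * (y - x).
Proof.
move=> dF; have [xy|/ltW yx] := leP x y.
  have [c /andP[xc cy] cE] := MVT_is_derive dF xy.
  by exists c; split=> //; rewrite !ger0_norm ?subr_ge0// lerD2r.
have [c /andP[yc cx] cE] := MVT_is_derive dF yx.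
exists c; split; first by rewrite !ler0_norm ?subr_le0// lerN2 lerD2r.
by rewrite -opprB cE -mulrN opprB.
Qed.

Lemma continuous_integrable g a b : continuous g ->
  lebesgue_measure.-integrable `[a, b] (EFin \o g).
Proof.
move=> cg; apply: continuous_compact_integrable; first exact: segment_compact.
exact: continuous_subspaceT.
Qed.

Lemma Rintegral_is_derive g G a b : continuous g ->
  (forall x, is_derive x (1 : R) G (g x)) -> a <= b ->
  \int[lebesgue_measure]_(x in `[a, b]) g x = G b - G a.
Proof.
move=> cg dG; rewrite le_eqVlt => /predU1P[->|ab].
  by rewrite subrr set_itv1 Rintegral_set1.
rewrite /Rintegral (@continuous_FTC2 _ g G)//.
- exact: continuous_subspaceT.
- have cG := is_derive_continuous dG; split.
  + by move=> x _; have [] := dG x.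
  + exact/cvg_at_right_filter/cG.
  + exact/cvg_at_left_filter/cG.
- by move=> x _; rewrite derive1E; have [_ ->] := dG x.
Qed.

(** Both sides are the integral from [y] to [x]. *)
Lemma Rintegral_base g c c' x y : continuous g ->
  c < x -> c < y -> c' < x -> c' < y ->
  \int[lebesgue_measure]_(t in `[c, x]) g t
    - \int[lebesgue_measure]_(t in `[c, y]) g t =
  \int[lebesgue_measure]_(t in `[c', x]) g t
    - \int[lebesgue_measure]_(t in `[c', y]) g t.
Proof.
move=> cg cx cy c'x c'y.
wlog yx : x y cx cy c'x c'y / y <= x.
  move=> H; have [yx|/ltW xy] := leP y x; first exact: H.
  by apply: oppr_inj; rewrite !opprB; exact: H.
rewrite !Rintegral_itvB//; try exact: continuous_integrable.
- by rewrite bnd_simp ltW.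
- by rewrite bnd_simp ltW.
Qed.

(* The integral starts to the left of both [0] and [x], which avoids integrals
   over reversed intervals; its value does not depend on the starting point. *)
Lemma exists_primitive g : continuous g ->
  exists G, forall x, is_derive x (1 : R) G (g x).
Proof.
move=> cg.
pose P c x := \int[lebesgue_measure]_(t in `[c, x]) g t.
exists (fun x => P (Num.min 0 x - 1) x - P (Num.min 0 x - 1) 0) => x.
pose c := Num.min 0 x - 2.
have cx : c < x by rewrite /c ltrBlDr gt_min; apply/orP; right; lra.
have c0 : c < 0 by rewrite /c ltrBlDr gt_min; apply/orP; left; lra.
apply: (@near_eq_is_derive _ _ _ (fun y => P c y - P c 0)).
  near=> y; apply: Rintegral_base => //.
  - by near: y; exact: lt_nbhsr.
  - by rewrite ltrBlDr gt_min; apply/orP; right; lra.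
  - by rewrite ltrBlDr gt_min; apply/orP; left; lra.
have [||dP P'] := @continuous_FTC1_closed _ g c x (x + 1) _ _ cx (cg x).
- lra.
- exact: continuous_integrable.
rewrite -P' derive1E; rewrite -[X in is_derive _ _ _ X]subr0.
apply: is_deriveB; apply: DeriveDef => //.
Unshelve. all: by end_near. Qed.

(** Compactness in its near-covering form, the parameter being a radius that tends to 0 from the
    right. *)
Lemma heine_cantor f a b : continuous f -> forall e : R, 0 < e ->
  exists2 d : R, 0 < d & forall x y, a <= x <= b -> `|x - y| < d ->
    `|f x - f y| < e.
Proof.
move=> cf e e0.
have /compact_near_coveringP/(_ R 0^'+
    (fun d x => forall y, `|x - y| < d -> `|f x - f y| < e)) := @segment_compact R a b.
case.
  move=> x _; have e20 : 0 < e / 2 by rewrite divr_gt0.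
  have /cvgrPdist_lt/(_ _ e20)/nbhs_ballP[r /= r0 rP] := cf x.
  exists ((ball x (r / 2) : set R), (ball (0 : R) (r / 2) : set R) `&` [set d : R | 0 < d]) => /=.
    split; first by apply: nbhsx_ballx; rewrite divr_gt0.
    by exists (r / 2) => /=; [rewrite divr_gt0|move=> d ? ?; split].
  move=> [z d]/= [zx [+ d0]] y; rewrite /ball/= sub0r normrN gtr0_norm// => dr zy.
  have xz : `|x - z| < r / 2 by [].
  have /rP h1 : ball x r z by rewrite /ball/=; apply: lt_trans xz _; lra.
  have /rP h2 : ball x r y.
    rewrite /ball/= -(subrKA z) (le_lt_trans (ler_normD _ _))//.
    by rewrite (splitr r) ltrD// (lt_trans zy).
  rewrite -(subrKA (f x)) (le_lt_trans (ler_normD _ _))//.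
  by rewrite (splitr e) ltrD// distrC.
move=> d/= d0 dP; exists (d / 2); first by rewrite divr_gt0.
move=> x y xab xy; apply: (dP (d / 2)) => //=.
- by rewrite sub0r normrN gtr0_norm ?divr_gt0//; lra.
- by rewrite divr_gt0.
Qed.

(** Paths are only known to be continuous on [[0, 1]]; composed with [clamp] they
    become continuous on the whole line. *)
Definition clamp (t : R) : R := Num.max 0 (Num.min 1 t).

Lemma clamp_itv t : 0 <= clamp t <= 1.
Proof. by rewrite /clamp le_max lexx ge_max ler01/= ge_min lexx. Qed.

Lemma clamp_id t : 0 <= t <= 1 -> clamp t = t.
Proof. by move=> /andP[t0 t1]; rewrite /clamp min_r// max_r. Qed.

Lemma clamp_lipschitz s t : `|clamp s - clamp t| <= `|s - t|.
Proof.
wlog st : s t / s <= t => [h|].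
  have [/h //|/ltW ts] := leP s t.
  by rewrite distrC [leRHS]distrC; exact: h.
have clampP u : [\/ clamp u = 0 /\ u <= 0, [/\ clamp u = u, 0 <= u & u <= 1]
    | clamp u = 1 /\ 1 <= u].
  have [u0|u0] := leP u 0.
    apply: Or31; split=> //; rewrite /clamp min_r ?max_l//; lra.
  have [u1|u1] := leP u 1.
    by apply: Or32; rewrite clamp_id ?u1 ?andbT; [split=> //; lra|lra].
  by apply: Or33; rewrite /clamp min_l ?max_r//; [split=> //|]; lra.
rewrite (ler0_norm (_ : s - t <= 0)) ?subr_le0// ler_norml.
by case: (clampP s) => -[-> *]; case: (clampP t) => -[-> *]; apply/andP; split; lra.
Qed.

Lemma continuous_clamp f :
  {within `[0, 1], continuous f} -> continuous (f \o clamp).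
Proof.
move=> /subspace_continuousP cf t.
have /cf cft : `[0%R, 1%R]%classic (clamp t) by rewrite /= in_itv/= clamp_itv.
apply/cvgrPdist_lt => e e0.
have /cvgrPdist_lt/(_ _ e0)[r /= r0 rP] := cft.
near=> s; apply: rP => /=; last by rewrite in_itv/= clamp_itv.
apply: le_lt_trans (clamp_lipschitz _ _) _.
by near: s; exact: (nbhsx_ballx t r r0).
Unshelve. all: by end_near. Qed.

End primitives.


(** * Chain rule for paths of vanishing quadratic variation *)

Section chain_rule.
Context {R : realType}.

Lemma sqr_normM (u : R) : u ^+ 2 = `|u| * `|u|.
Proof. by rewrite -normrM -expr2 ger0_norm ?sqr_ge0. Qed.

Lemma taylor_lipschitz (F l : R -> R) (K y z : R) :
  (forall u, is_derive u (1 : R) F (l u)) ->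
  (forall u v, `|l u - l v| <= K * `|u - v|) ->
  `|F z - F y - l y * (z - y)| <= K * (z - y) ^+ 2.
Proof.
move=> dF lK.
have [c [cyz ->]] := MVT_dist y z dF.
rewrite -mulrBl normrM sqr_normM mulrA ler_wpM2r//.
have K0 : 0 <= K by have := lK 1 0; rewrite subr0 normr1 mulr1; apply: le_trans.
by apply: le_trans (lK _ _) _; rewrite ler_wpM2l.
Qed.

Lemma ler_sqr_add3 (a b c : R) :
  (a + b + c) ^+ 2 <= 3 * (a ^+ 2 + b ^+ 2 + c ^+ 2).
Proof.
have := sqr_ge0 (a - b); have := sqr_ge0 (b - c); have := sqr_ge0 (a - c); nra.
Qed.

(** Since [l (x t) * g t = 1], the first order term of [Lam] along [x] produces exactly the
    increment of [beta]. The Taylor remainder is at most [K] times the squared increment of [x],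
    which splits into drift, [beta] and Riemann-Stieltjes error; each part sums to something
    small. *)
Lemma RS_chain_rule (x beta alpha A G Lam l g I : R -> R) (T K L M : R) :
  0 <= T -> continuous x ->
  (forall t, is_derive t (1 : R) A (alpha t)) ->
  (forall t, is_derive t (1 : R) G (l (x t) * alpha t)) ->
  (forall y, is_derive y (1 : R) Lam (l y)) ->
  (forall t, `|alpha t| <= M) -> (forall t, `|g t| <= M) ->
  (forall y, `|l y| <= L) -> (forall y z, `|l y - l z| <= K * `|y - z|) ->
  (forall t, l (x t) * g t = 1) ->
  (forall t : R, 0 <= t <= T -> forall e : R, 0 < e ->
    exists2 delta : R, 0 < delta &
    forall v, tagged_sum g beta delta 0 t v -> `|v - I t| < e) ->
  (forall t, 0 <= t <= T -> x t = x 0 + (A t - A 0) + I t) ->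
  (forall (e : R) N, 0 < e -> exists2 n, (N < n)%N &
    \sum_(0 <= i < n)
      (beta (T * i.+1%:R / n%:R) - beta (T * i%:R / n%:R)) ^+ 2 < e) ->
  Lam (x T) - Lam (x 0) = beta T - beta 0 + (G T - G 0).
Proof.
rewrite le_eqVlt => /predU1P[<-|T0]; first by rewrite !subrr addr0.
move=> cx dA dG dLam aM gM lL lK lg RS xE QV.
have M0 : 0 <= M by apply: le_trans (normr_ge0 _) (gM 0).
have L0 : 0 <= L by apply: le_trans (normr_ge0 _) (lL 0).
have K0 : 0 <= K.
  by have := lK 1 0; rewrite subr0 normr1 mulr1; apply: le_trans.
pose E s t := Lam (x t) - Lam (x s) - (beta t - beta s) - (G t - G s).
pose r s t := g s * (beta t - beta s) - (I t - I s).
have Ebound e s t : 0 < e -> 0 <= s -> s <= t -> t <= T -> t - s <= e ->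
    `|r s t| <= e -> (forall u, s <= u <= t -> `|x s - x u| <= e) ->
    `|E s t| <= L * `|r s t| + K * e * M * (t - s) +
      3 * K * (M ^+ 2 * e * (t - s) + M ^+ 2 * (beta t - beta s) ^+ 2
               + e * `|r s t|).
  move=> e0 s0 st tT tse re xe.
  have sT : 0 <= s <= T by rewrite s0 (le_trans st).
  have tI : 0 <= t <= T by rewrite tT (le_trans s0).
  have dx : x t - x s = (A t - A s) + g s * (beta t - beta s) + - r s t.
    by rewrite (xE _ sT) (xE _ tI) /r; ring.
  have dAs : `|A t - A s| <= M * (t - s).
    have [c _ ->] := MVT_is_derive dA st.
    by rewrite normrM (ger0_norm (_ : 0 <= t - s)) ?subr_ge0// ler_wpM2r ?subr_ge0.
  have dGA : `|l (x s) * (A t - A s) - (G t - G s)| <= K * e * M * (t - s).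
    have dGA u : is_derive u (1 : R) (fun v => l (x s) * A v - G v)
        (l (x s) * alpha u - l (x u) * alpha u).
      exact: is_deriveB.
    have [c cst] := MVT_is_derive dGA st.
    have -> : l (x s) * A t - G t - (l (x s) * A s - G s) =
      l (x s) * (A t - A s) - (G t - G s) by ring.
    move=> ->; rewrite normrM (ger0_norm (_ : 0 <= t - s)) ?subr_ge0//.
    rewrite ler_wpM2r ?subr_ge0// -mulrBl normrM ler_pM//.
    by apply: le_trans (lK _ _) _; rewrite ler_wpM2l// xe.
  have tay := taylor_lipschitz (x s) (x t) dLam lK.
  (* Taylor remainder, plus the cost of freezing [l] at time [s] in the drift, minus the weighted
     Riemann-Stieltjes error. *)
  have -> : E s t = (Lam (x t) - Lam (x s) - l (x s) * (x t - x s))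
     + (l (x s) * (A t - A s) - (G t - G s)) - l (x s) * r s t.
    by rewrite dx /E mulrDr mulrDr mulrA lg; ring.
  apply: le_trans (ler_normB _ _) _.
  have lr : `|l (x s) * r s t| <= L * `|r s t| by rewrite normrM ler_wpM2r.
  have dx2 : (x t - x s) ^+ 2 <= 3 * (M ^+ 2 * e * (t - s)
      + M ^+ 2 * (beta t - beta s) ^+ 2 + e * `|r s t|).
    rewrite dx; apply: le_trans (ler_sqr_add3 _ _ _) _; rewrite ler_wpM2l//.
    rewrite sqrrN !lerD//.
    - rewrite sqr_normM (le_trans (ler_pM _ _ dAs dAs))//.
      have -> : M * (t - s) * (M * (t - s)) = M ^+ 2 * (t - s) * (t - s) by ring.
      by rewrite ler_wpM2r ?subr_ge0// ler_wpM2l ?sqr_ge0.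
    - rewrite exprMn ler_wpM2r ?sqr_ge0// (sqr_normM (g s)) (expr2 M).
      exact: ler_pM.
    - by rewrite sqr_normM ler_wpM2r.
  have := ler_normD (Lam (x t) - Lam (x s) - l (x s) * (x t - x s))
    (l (x s) * (A t - A s) - (G t - G s)).
  have := ler_wpM2l K0 dx2.
  by rewrite mulrCA mulrA; lra.
(* The coefficients of [Ebound] after summation: the lengths add up to [T], the squared increments
   of [beta] to less than [e], and the [|r|] to less than [e <= 1]. *)
pose C := L + K * M * T + 3 * K * (M ^+ 2 * T + M ^+ 2 + 1).
have C0 : 0 <= C.
  by rewrite /C !(addr_ge0, mulr_ge0)// ?sqr_ge0// ltW.
suff EC e : 0 < e -> e <= 1 -> `|E 0 T| <= C * e.
  suff : E 0 T = 0 by rewrite /E; lra.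
  apply/eqP; rewrite -normr_le0; apply/ler_addgt0Pl => e e0; rewrite addr0.
  pose e' := Num.min 1 (e / (C + 1)).
  have C10 : 0 < C + 1 by rewrite ltr_wpDl.
  have e'0 : 0 < e' by rewrite lt_min ltr01/= divr_gt0.
  apply: le_trans (EC e' e'0 _) _; first by rewrite ge_min lexx.
  have : e' <= e / (C + 1) by rewrite ge_min lexx orbT.
  rewrite ler_pdivlMr// => h; apply: le_trans h; rewrite mulrC ler_wpM2l ?ltW//.
  by rewrite ltrDl.
move=> e0 e1.
have [d1 d10 SH] := saks_henstock (ltW T0) RS e0.
have [d2 d20 UC] := heine_cantor 0 T cx e0.
pose d := Num.min e (Num.min d1 d2).
have d0 : 0 < d by rewrite !lt_min e0 d10.
(* This lower bound on [n] makes the mesh [T / n] smaller than [d]. *)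
have [n nT qv] := QV e (Num.bound (T / d)) e0.
have n0 : 0 < n%:R :> R by rewrite ltr0n (leq_ltn_trans _ nT).
pose p i := T * i%:R / n%:R.
have pE i : p i.+1 - p i = T / n%:R.
  by rewrite /p -mulrBl -mulrBr -natrB// subSnn mulr1.
have Tn : T / n%:R < d.
  rewrite ltr_pdivrMr// mulrC -ltr_pdivrMr//.
  apply: lt_trans (archi_boundP (divr_ge0 (ltW T0) (ltW d0))) _.
  by rewrite ltr_nat.
have Tn0 : 0 < T / n%:R by rewrite divr_gt0.
have dle : [/\ d <= e, d <= d1 & d <= d2].
  by rewrite /d; split; rewrite !ge_min lexx ?orbT.
case: dle => de dd1 dd2.
have p0 : p 0%N = 0 by rewrite /p mulr0 mul0r.
have pn : p n = T by rewrite /p mulfK// gt_eqF.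
have pge0 i : 0 <= p i by rewrite /p divr_ge0// ?mulr_ge0// ?ltW.
have pleT i : (i <= n)%N -> p i <= T.
  by move=> ni; rewrite /p ler_pdivrMr// ler_wpM2l ?(ltW T0)// ler_nat.
have psum : \sum_(0 <= i < n) `|r (p i) (p i.+1)| < e.
  apply: SH => // i; first by rewrite -subr_gt0 pE.
  by rewrite pE (lt_le_trans Tn).
have rle i : (i < n)%N -> `|r (p i) (p i.+1)| <= e.
  move=> ni; apply: le_trans (ltW psum).
  rewrite big_mkord (bigD1 (Ordinal ni))//= lerDl.
  by apply: sumr_ge0 => *; exact: normr_ge0.
have -> : E 0 T = \sum_(0 <= i < n) E (p i) (p i.+1).
  pose Phi t := Lam (x t) - beta t - G t.
  have -> : E 0 T = Phi (p n) - Phi (p 0%N) by rewrite pn p0 /E /Phi; ring.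
  by rewrite -(telescope_sumr (fun i => Phi (p i)) (leq0n n)); apply: eq_bigr => i _; rewrite /E /Phi; ring.
apply: le_trans (ler_norm_sum _ _ _) _.
apply: (@le_trans _ _ (\sum_(0 <= i < n)
   (L * `|r (p i) (p i.+1)| + K * e * M * (T / n%:R) +
      3 * K * (M ^+ 2 * e * (T / n%:R)
               + M ^+ 2 * (beta (p i.+1) - beta (p i)) ^+ 2
               + e * `|r (p i) (p i.+1)|)))).
  rewrite big_nat_cond [leRHS]big_nat_cond; apply: ler_sum => i.
  rewrite andbT => /andP[_ ni]; rewrite -(pE i); apply: Ebound => //.
  - by rewrite -subr_ge0 pE ltW.
  - exact: pleT.
  - by rewrite pE ltW// (lt_le_trans Tn).
  - exact: rle.
  - move=> u /andP[pu up]; apply/ltW/UC; first by rewrite pge0 pleT// ltnW.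
    rewrite distrC ger0_norm ?subr_ge0//; apply: (@lt_le_trans _ _ d) => //.
    by apply: le_lt_trans Tn; rewrite -(pE i) lerD2r.
rewrite !big_split/= -!mulr_sumr !big_split/= -!mulr_sumr.
have -> : \sum_(0 <= i < n) n%:R^-1 = 1 :> R.
  by rewrite sumr_const_nat subn0 -(mulr_natr n%:R^-1) mulVf// gt_eqF.
rewrite mulr1.
set S := \sum_(0 <= i < n) `|_| in psum *.
have S0 : 0 <= S by apply: sumr_ge0 => *; exact: normr_ge0.
set Q := \sum_(0 <= i < n) _ ^+ 2.
have Qe : Q < e by [].
have -> : C * e = L * e + K * e * M * T
    + 3 * K * (M ^+ 2 * e * T + M ^+ 2 * e + e) by rewrite /C; ring.
have LS : L * S <= L * e by rewrite ler_wpM2l// ltW.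
have MQ : M ^+ 2 * Q <= M ^+ 2 * e by rewrite ler_wpM2l ?sqr_ge0// ltW.
have eS : e * S <= e.
  by rewrite ler_piMr ?(ltW e0)// (le_trans (ltW psum)).
by rewrite !lerD// ler_wpM2l ?mulr_ge0// !lerD.
Qed.

End chain_rule.


(** * Gaussian variables *)

Section normal_law.
Context {R : realType}.
Local Notation mu := (@lebesgue_measure R).
Implicit Types (m s x y r : R).

Lemma normal_peak_le s v : s != 0 -> 0 < v -> v <= s ^+ 2 ->
  normal_peak s <= (Num.sqrt v)^-1.
Proof.
move=> s0 v0 vs.
have peak0 : 0 < s ^+ 2 * pi *+ 2.
  by rewrite pmulrn_lgt0// mulr_gt0 ?pi_gt0// exprn_even_gt0.
rewrite /normal_peak lef_pV2 ?posrE ?sqrtr_gt0// ler_sqrt ?(ltW peak0)//.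
apply: le_trans vs _; rewrite -mulrnAr ler_peMr ?sqr_ge0// -mulr_natr.
by have := pi_ge2 R; lra.
Qed.

Lemma normal_prob_itv_le m s r : s != 0 -> 0 <= r ->
  (normal_prob m s `[(- r)%R, r] <= (2 * r * normal_peak s)%:E)%E.
Proof.
move=> s0 r0; rewrite /normal_prob.
apply: (@le_trans _ _ (\int[mu]_(x in `[(- r)%R, r]) (normal_peak s)%:E)%E).
  apply: ge0_le_integral => //=.
  - by move=> x _; rewrite lee_fin normal_pdf_ge0.
  - by apply: measurable_funTS; apply/measurable_EFinP; exact: measurable_normal_pdf.
  - by move=> x _; rewrite lee_fin normal_pdf_ub.
rewrite integral_cst//= lebesgue_measure_itv/= lte_fin.
case: ifP => _; last by rewrite mule0 lee_fin !mulr_ge0// normal_peak_ge0.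
by rewrite -EFinD -EFinM lee_fin; have := normal_peak_ge0 s; lra.
Qed.

Lemma normal_prob_itv_gt0 m s y r : s != 0 -> 0 < r ->
  (0 < normal_prob m s `](y - r)%R, (y + r)%R[)%E.
Proof.
move=> s0 r0; rewrite /normal_prob.
pose c := normal_peak s * expR (- (`|y - m| + r) ^+ 2 / (s ^+ 2 *+ 2)).
have c0 : 0 < c by rewrite mulr_gt0 ?expR_gt0// normal_peak_gt0.
apply: (@lt_le_trans _ _ (\int[mu]_(x in `](y - r)%R, (y + r)%R[) c%:E)%E).
  rewrite integral_cst//= lebesgue_measure_itv/= lte_fin.
  have -> : y - r < y + r by lra.
  by rewrite -EFinD -EFinM lte_fin mulr_gt0//; lra.
apply: ge0_le_integral => //=.
- by move=> x _; rewrite lee_fin ltW.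
- by apply: measurable_funTS; apply/measurable_EFinP; exact: measurable_normal_pdf.
- move=> x; rewrite in_itv/= => /andP[x1 x2].
  rewrite lee_fin normal_pdfE// /normal_fun ler_wpM2l ?normal_peak_ge0//.
  rewrite ler_expR !mulNr lerN2 ler_pM2r; last first.
    by rewrite invr_gt0 pmulrn_lgt0// exprn_even_gt0.
  rewrite -real_normK ?num_real// ler_sqr ?nnegrE//; last first.
    by rewrite addr_ge0// ltW.
  rewrite -(subrKA y) (le_trans (ler_normD _ _))// addrC lerD2l.
  by rewrite ler_norml; apply/andP; split; lra.
Qed.

(* With [w = (x - m)^2 / (8 s^2)] this is [w * exp (- 4 w) <= exp (- w)]. *)
Lemma normal_pdf_double m s x : s != 0 ->
  (x - m) ^+ 2 * normal_pdf m s x <= 16 * s ^+ 2 * normal_pdf m (2 * s) x.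
Proof.
move=> s0; have s20 : 2 * s != 0 by rewrite mulf_neq0.
rewrite !normal_pdfE// /normal_fun.
have -> : normal_peak (2 * s) = normal_peak s / 2.
  rewrite /normal_peak -invfM; congr (_^-1).
  have -> : (2 * s) ^+ 2 * pi *+ 2 = (s ^+ 2 * pi *+ 2) * 2 ^+ 2.
    by ring.
  rewrite sqrtrM ?sqrtr_sqr ?ger0_norm//.
  by rewrite mulrn_wge0// mulr_ge0 ?sqr_ge0// pi_ge0.
pose w := (x - m) ^+ 2 / (8 * s ^+ 2).
have w0 : 0 <= w by apply: divr_ge0; [exact: sqr_ge0|apply: mulr_ge0; [|exact: sqr_ge0]].
have -> : - (x - m) ^+ 2 / (s ^+ 2 *+ 2) = - w + - (3 * w).
  by rewrite /w; field.
have -> : - (x - m) ^+ 2 / ((2 * s) ^+ 2 *+ 2) = - w.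
  by rewrite /w; field.
have -> : (x - m) ^+ 2 = 8 * s ^+ 2 * w by rewrite /w; field.
rewrite expRD [expR (- (3 * w))]expRN.
have : w / expR (3 * w) <= 1.
  by rewrite ler_pdivrMr ?expR_gt0// mul1r; have := expR_ge1Dx (3 * w); lra.
set e3 := expR (3 * w); set e1 := expR (- w) => h.
have c0 : 0 <= 8 * s ^+ 2 * normal_peak s * e1.
  by rewrite mulr_ge0 ?expR_ge0// mulr_ge0 ?normal_peak_ge0// mulr_ge0 ?sqr_ge0.
have := ler_wpM2l c0 h; rewrite mulr1 => h'.
by apply: le_trans (le_trans h' _); [|]; lra.
Qed.

(** The Radon-Nikodym derivative of [normal_prob m s] agrees almost everywhere with
    [normal_pdf m s], both having the same integral over every measurable set. *)
Lemma integral_normal_prob m s (f : R -> \bar R) : s != 0 ->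
  (normal_prob m s).-integrable setT f ->
  (\int[normal_prob m s]_x f x =
   \int[mu]_x (f x * (normal_pdf m s x)%:E))%E.
Proof.
move=> s0 fi; have dom := normal_prob_dominates m s.
rewrite -(Radon_Nikodym_change_of_variables dom)//=.
apply: ae_eq_integral => //.
- apply: emeasurable_funM; first exact: (measurable_int (normal_prob m s)).
  apply: (measurable_int mu).
  by apply: Radon_Nikodym_integrable; exact: dom.
- apply: emeasurable_funM => //=; first exact: (measurable_int (normal_prob m s)).
  by apply/measurable_EFinP; exact: measurable_normal_pdf.
- apply: ae_eqe_mul2l => /=.
  rewrite Radon_NikodymE//=.
  case: cid => /= h [h1 h2 h3].
  apply: integral_ae_eq => //=.
  + by apply/measurable_EFinP; exact: measurable_normal_pdf.
  + by move=> E E01 mE; rewrite -h3.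
Qed.

(** By [normal_pdf_double] the second moment is at most [16 * s ^+ 2] times the total mass of a
    normal law of scale [2 * s]. *)
Lemma normal_prob_sqr m s : s != 0 ->
  (normal_prob m s).-integrable setT (fun x => ((x - m) ^+ 2)%:E) ->
  (\int[normal_prob m s]_x ((x - m) ^+ 2)%:E <= (16 * s ^+ 2)%:E)%E.
Proof.
move=> s0 fi; rewrite integral_normal_prob//.
apply: (@le_trans _ _ (\int[mu]_x ((16 * s ^+ 2)%:E * (normal_pdf m (2 * s) x)%:E))%E).
  apply: ge0_le_integral => //=.
  - by move=> x _; rewrite -EFinM lee_fin mulr_ge0 ?sqr_ge0 ?normal_pdf_ge0.
  - apply: emeasurable_funM; first exact: (measurable_int (normal_prob m s)).
    by apply/measurable_EFinP; exact: measurable_normal_pdf.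
  - apply: emeasurable_funM => //.
    by apply/measurable_EFinP; exact: measurable_normal_pdf.
  - by move=> x _; rewrite -!EFinM lee_fin normal_pdf_double.
rewrite integralZl//; last exact: integrable_normal_pdf.
by rewrite integral_normal_pdf mule1.
Qed.

End normal_law.


(** * Gaussian variables of positive variance *)

Section gaussian_rv.
Context {R : realType} d (T : measurableType d) (P : probability T R).

(** The event that all [A k] with [k > K] occur is contained in events of arbitrarily small
    probability. This stands in for Borel-Cantelli. *)
Lemma ae_frequently_notin (A : nat -> set T) : (forall k, measurable (A k)) ->
  (forall e : R, 0 < e -> forall K, exists2 k, (K < k)%N & (P (A k) <= e%:E)%E) ->
  {ae P, forall w, forall K, exists2 k, (K < k)%N & ~ A k w}.
Proof.
move=> mA PA; apply: ae_foralln => K.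
have mcap : measurable (\bigcap_(k in [set k | (K < k)%N]) A k).
  by apply: bigcap_measurable => //; exists K.+1 => /=.
exists (\bigcap_(k in [set k | (K < k)%N]) A k); split=> //.
- apply/eqP; rewrite eq_le measure_ge0 andbT.
  apply/lee_addgt0Pr => e e0; rewrite add0e.
  have [k Kk Pk] := PA e e0 K; apply: le_trans Pk.
  apply: le_measure; rewrite ?inE//.
  exact: bigcap_inf.
- move=> w /= nA k /= Kk; apply: contrapT => nAk; apply: nA.
  by exists k.
Qed.

Lemma Lfun2_sqr (Y : {RV P >-> R}) : (\int[P]_w ((Y w) ^+ 2)%:E < +oo)%E ->
  (Y : T -> R) \in Lfun P 2%:E.
Proof.
move=> Yfin; rewrite inE; apply/andP; split; rewrite inE/=.
  exact: measurable_funP.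
rewrite /finite_norm unlock; apply: poweR_lty.
apply: le_lt_trans Yfin; rewrite le_eqVlt; apply/orP; left; apply/eqP.
by apply: eq_integral => w _; rewrite poweR_EFin powR_mulrn// real_normK ?num_real.
Qed.

(** To be used with [c] the parameter [m] of the law, which has not been identified with the
    mean. *)
Lemma variance_le_sqr (Y : {RV P >-> R}) (c : R) :
  (Y : T -> R) \in Lfun P 2%:E ->
  ('V_P[Y] <= \int[P]_w ((Y w - c) ^+ 2)%:E)%E /\
  (\int[P]_w ((Y w - c) ^+ 2)%:E < +oo)%E.
Proof.
move=> Y2.
have Yc2 : (Y \- cst c : T -> R) \in Lfun P 2%:E.
  by rewrite rpredB ?lee1n//= => _; rewrite Lfun_cst.
have -> : (\int[P]_w ((Y w - c) ^+ 2)%:E = 'E_P[(Y \- cst c)%R ^+ 2])%E.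
  by rewrite unlock; apply: eq_integral.
have Yc1 : (Y \- cst c : T -> R) \in Lfun P 1.
  by apply: Lfun_subset12 => //; exact: fin_num_measure.
have fE := expectation_fin_num Yc1.
split.
- rewrite -(varianceB_cst_r c Y2) varianceE//.
  by rewrite leeBlDr ?fin_numX// leeDl// sqre_ge0.
- have := Lfun2_integrable_sqr Yc2 => /integrableP[_].
  apply: le_lt_trans; rewrite unlock le_eqVlt; apply/orP; left; apply/eqP.
  by apply: eq_integral => w _ /=; rewrite ger0_norm ?sqr_ge0.
Qed.

(** A point mass at [m] has second moment 0 about [m], which positive variance forbids; in the other
    case [normal_prob_sqr] bounds the scale from below. *)
Lemma gaussian_rv_law (Y : {RV P >-> R}) (v : R) : gaussian_rv P Y ->
  (Y : T -> R) \in Lfun P 2%:E -> 'V_P[Y]%E = v%:E -> 0 < v ->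
  exists m s : R, [/\ s != 0, v <= 16 * s ^+ 2 &
    forall A : set R, measurable A -> P (Y @^-1` A) = normal_prob m s A].
Proof.
move=> [_ gY] Y2 Yv v0.
have msqr (m : R) : measurable_fun setT
    (fun x : measurableTypeR R => ((x - m) ^+ 2)%:E).
  have : measurable_fun setT (fun x : R => (x - m) ^+ 2).
    by apply: measurable_funX; exact: measurable_funB.
  by move=> h; apply/measurable_EFinP.
(* [R] and [measurableTypeR R] have the same measurable sets but different
   displays; [normal_prob] is a measure on the latter. *)
have mY : @measurable_fun _ _ T (measurableTypeR R) setT Y := measurable_funP Y.
pose Y' : {mfun T >-> measurableTypeR R} :=
  HB.pack (Y : T -> _) (isMeasurableFun.Build _ _ _ _ _ mY).
have sqrE (m : R) (mu : {measure set (measurableTypeR R) -> \bar R}) :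
    (forall A : set R, measurable A -> P (Y @^-1` A) = mu A) ->
    (\int[P]_w ((Y w - m) ^+ 2)%:E = \int[mu]_x ((x - m) ^+ 2)%:E)%E.
  move=> YA.
  have -> : (\int[P]_w ((Y w - m) ^+ 2)%:E =
      \int[distribution P Y']_x ((x - m) ^+ 2)%:E)%E.
    by rewrite ge0_integral_distribution// => x; rewrite lee_fin sqr_ge0.
  by apply: eq_measure_integral => A mA _; exact: YA.
case: gY => [[m [s [s0 YA]]]|[m YA]].
- exists m, s; split=> //.
  have [] := variance_le_sqr m Y2; rewrite Yv (sqrE _ (normal_prob m s))// => h1 h2.
  rewrite -lee_fin; apply: le_trans h1 _; apply: normal_prob_sqr => //.
  apply/integrableP; split; first exact: msqr.
  apply: le_lt_trans h2; rewrite le_eqVlt; apply/orP; left; apply/eqP.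
  by apply: eq_integral => w _ /=; rewrite ger0_norm ?sqr_ge0.
- have [] := variance_le_sqr m Y2; rewrite Yv (sqrE _ (@dirac _ (measurableTypeR R) m R))//.
  rewrite integral_dirac//.
  by rewrite subrr expr0n/= mule0 lee_fin leNgt v0.
Qed.

(** As [s ^+ 2 >= v / 16], the density is at most [4 / Num.sqrt v], and the interval has length
    [2 * r]. *)
Lemma gaussian_rv_small_ball (Y : {RV P >-> R}) (v r : R) : gaussian_rv P Y ->
  (Y : T -> R) \in Lfun P 2%:E -> 'V_P[Y]%E = v%:E -> 0 < v -> 0 <= r ->
  (P [set w | (`|Y w| <= r)%R] <= (8 * r / Num.sqrt v)%:E)%E.
Proof.
move=> gY Y2 Yv v0 r0; have [m [s [s0 vs YA]]] := gaussian_rv_law gY Y2 Yv v0.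
have -> : [set w | (`|Y w| <= r)%R] = Y @^-1` `[- r, r].
  by apply/seteqP; split=> w /=; rewrite in_itv/= ler_norml.
rewrite YA//; apply: le_trans (normal_prob_itv_le _ s0 r0) _; rewrite lee_fin.
have v160 : 0 < v / 16 by rewrite divr_gt0.
have /(normal_peak_le s0 v160) : v / 16 <= s ^+ 2 by lra.
have -> : Num.sqrt (v / 16) = Num.sqrt v / 4.
  rewrite sqrtrM ?ltW// sqrtrV//; congr (_ / _).
  by rewrite (_ : 16 = 4 ^+ 2) ?sqrtr_sqr ?ger0_norm// expr2 -natrM.
rewrite invfM invrK => h.
apply: le_trans (ler_wpM2l (_ : 0 <= 2 * r) h) _; first by rewrite mulr_ge0.
by rewrite le_eqVlt; apply/orP; left; apply/eqP; ring.
Qed.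

(** An event of positive probability is not contained in the exceptional null set of [Q]. *)
Lemma gaussian_rv_full_support (Y : {RV P >-> R}) (v y r : R) (Q : T -> Prop) :
  gaussian_rv P Y ->
  (Y : T -> R) \in Lfun P 2%:E -> 'V_P[Y]%E = v%:E -> 0 < v -> 0 < r ->
  {ae P, forall w, Q w} -> exists w, `|Y w - y| < r /\ Q w.
Proof.
move=> gY Y2 Yv v0 r0 [N [mN N0 QN]].
have [m [s [s0 vs YA]]] := gaussian_rv_law gY Y2 Yv v0.
have := normal_prob_itv_gt0 m y s0 r0; rewrite -YA//.
apply: contraPP => nQ; apply/negP; rewrite -leNgt -[leRHS]N0.
apply: le_measure; rewrite ?inE//.
  by rewrite -[X in measurable X]setTI; exact: measurable_funP.
move=> w /=; rewrite in_itv/= => /andP[y1 y2]; apply: QN => /= Qw; apply: nQ.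
by exists w; split=> //; rewrite ltr_norml; apply/andP; split; lra.
Qed.

End gaussian_rv.


(** * Fractional Brownian motion *)

Section fractional_brownian_motion.
Context {R : realType} d (T : measurableType d) (P : probability T R) (H : R).
Context (B : R -> {RV P >-> R}) (B_fbm : fractional_brownian_motion H B).
Context (H_gt : 1 < 2 * H).

Let H20 : 2 * H != 0. Proof. by rewrite gt_eqF// (lt_trans ltr01). Qed.

Lemma fbm_variance t : t \in `[0, 1] -> 'V_P[B t]%E = (t `^ (2 * H))%:E.
Proof.
move=> tI; have [_ _ cov _] := B_fbm; rewrite /variance cov//.
by rewrite subrr normr0 powR0//; congr EFin; lra.
Qed.

(** Read off the covariance before any integrability is known; its finiteness is what puts [B t] in
    L2. *)
Lemma fbm_sqr t : t \in `[0, 1] ->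
  (\int[P]_w ((B t w) ^+ 2)%:E = (t `^ (2 * H))%:E)%E.
Proof.
move=> tI; rewrite -fbm_variance// /variance unlock.
have [_ EB _ _] := B_fbm; rewrite (EB _ tI) /= unlock.
by apply: eq_integral => w _; rewrite /= !fctE/= subr0 expr2.
Qed.

Lemma fbm_Lfun2 t : t \in `[0, 1] -> (B t : T -> R) \in Lfun P 2%:E.
Proof. by move=> tI; apply: Lfun2_sqr; rewrite fbm_sqr// ltry. Qed.

Lemma fbm_gaussian t : t \in `[0, 1] -> gaussian_rv P (B t).
Proof.
move=> tI; have [/(_ 1%N (fun=> t) (fun=> 1) (fun=> tI)) + _ _ _] := B_fbm.
congr gaussian_rv; apply/funext => w.
by rewrite big_ord_recl big_ord0 mul1r addr0.
Qed.

Lemma fbm_incr_gaussian s t : s \in `[0, 1] -> t \in `[0, 1] ->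
  gaussian_rv P (B t \- B s)%R.
Proof.
move=> sI tI; have [+ _ _ _] := B_fbm.
move=> /(_ 2%N (fun i => if i == ord0 then t else s)
           (fun i => if i == ord0 then 1 else -1)).
have tsI (i : 'I_2) : (if i == ord0 then t else s) \in `[0, 1] by case: ifP.
move=> /(_ tsI); congr gaussian_rv; apply/funext => w.
by rewrite !big_ord_recl big_ord0/= mul1r addr0 mulN1r.
Qed.

Lemma fbm_incr_Lfun2 s t : s \in `[0, 1] -> t \in `[0, 1] ->
  ((B t \- B s)%R : T -> R) \in Lfun P 2%:E.
Proof.
by move=> sI tI; rewrite rpredB ?lee1n//= => _; exact: fbm_Lfun2.
Qed.

Lemma fbm_incr_variance s t : s \in `[0, 1] -> t \in `[0, 1] ->
  'V_P[(B t \- B s)%R]%E = (`|t - s| `^ (2 * H))%:E.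
Proof.
move=> sI tI; have [_ _ cov _] := B_fbm.
rewrite varianceB ?fbm_Lfun2// !fbm_variance// cov//.
by rewrite -(EFinM 2) -EFinD distrC; congr EFin; field.
Qed.

Lemma fbm_incr_sqr s t : s \in `[0, 1] -> t \in `[0, 1] ->
  (\int[P]_w ((B t w - B s w) ^+ 2)%:E = (`|t - s| `^ (2 * H))%:E)%E.
Proof.
move=> sI tI; rewrite -fbm_incr_variance// varianceE ?fbm_incr_Lfun2//.
have B1 u : u \in `[0, 1] -> (B u : T -> R) \in Lfun P 1.
  by move=> uI; apply: Lfun_subset12; [exact: fin_num_measure|exact: fbm_Lfun2].
have [_ EB _ _] := B_fbm.
rewrite expectationB ?B1// !EB// sube0 expe2 mule0 sube0 unlock.
by apply: eq_integral.
Qed.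

Lemma fbm_start : {ae P, forall w, B 0 w = 0}.
Proof.
have I0 : (0 : R) \in `[0, 1] by rewrite in_itv/= lexx ler01.
have := fbm_sqr I0; rewrite powR0// => int0.
have mB2 : measurable_fun setT (fun w => ((B 0 w) ^+ 2)%:E).
  by apply/measurable_EFinP; apply: measurable_funX; exact: measurable_funP.
have [+ _] := @ae_eq_integral_abs _ _ _ P setT measurableT _ mB2.
have -> : (\int[P]_x `|((B 0 x) ^+ 2)%:E| = 0)%E.
  by rewrite -[RHS]int0; apply: eq_integral => w _; rewrite /= ger0_norm ?sqr_ge0.
move=> /(_ erefl); apply: filterS => w /= /(_ I) [].
by move/eqP; rewrite sqrf_eq0 => /eqP.
Qed.

End fractional_brownian_motion.


(** * Almost sure path properties: quadratic variation and failure of Lipschitz bounds *)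

Section paths.
Context {R : realType} d (T : measurableType d) (P : probability T R) (H : R).
Context (B : R -> {RV P >-> R}) (B_fbm : fractional_brownian_motion H B).
Context (H_gt : 1 < 2 * H).

Lemma small_powR (p e : R) : 0 < p -> 0 < e ->
  exists2 delta : R, 0 < delta & forall u, 0 <= u -> u <= delta -> u `^ p <= e.
Proof.
move=> p0 e0; exists (e `^ p^-1); first exact: powR_gt0.
move=> u u0 ud; rewrite -[leRHS](powRr1 (ltW e0)) -(mulVf (lt0r_neq0 p0)) powRrM.
by apply: (ge0_ler_powR (ltW p0)) => //; rewrite nnegrE ?powR_ge0.
Qed.

Lemma markov_ge0 (Q : T -> R) (c : R) : measurable_fun setT Q ->
  (forall w, 0 <= Q w) -> 0 < c ->
  (P [set w | (c <= Q w)%R] <= (c^-1)%:E * \int[P]_w (Q w)%:E)%E.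
Proof.
move=> mQ Q0 c0.
have mQE : measurable_fun setT (EFin \o Q) by exact/measurable_EFinP.
have := @le_integral_comp_abse _ _ _ P setT measurableT (EFin \o Q) c id _ _ _ mQE c0.
move=> /(_ ltac:(exact: measurable_id) (fun r r0 => r0)) => h.
have {}h := h (fun x y _ _ xy => xy).
rewrite setTI in h.
rewrite -lee_pdivrMl ?invr_gt0// invrK.
apply: le_trans (le_trans h _).
  rewrite le_eqVlt; apply/orP; left; apply/eqP; congr (_ * P _)%E.
  by apply/seteqP; split => w /=; rewrite lee_fin ger0_norm.
rewrite le_eqVlt; apply/orP; left; apply/eqP; apply: eq_integral => w _ /=.
by rewrite ger0_norm.
Qed.

(** The sum has mean [n * (t / n) ^ (2H)], at most [(t / n) ^ (2H - 1)], which tends to 0.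
    Convergence in mean yields smallness for infinitely many [n], which is what [RS_chain_rule] asks
    for. *)
Lemma fbm_quadratic_variation t : 0 < t -> t <= 1 ->
  {ae P, forall w, forall (e : R) N, 0 < e -> exists2 n, (N < n)%N &
    \sum_(0 <= i < n)
      (B (t * i.+1%:R / n%:R) w - B (t * i%:R / n%:R) w) ^+ 2 < e}.
Proof.
move=> t0 t1.
pose p n i := t * i%:R / n%:R.
pose Q n w := \sum_(0 <= i < n) (B (p n i.+1) w - B (p n i) w) ^+ 2.
have mD n i : measurable_fun setT
    (fun w => (B (p n i.+1) w - B (p n i) w) ^+ 2).
  by apply: measurable_funX; apply: measurable_funB; exact: measurable_funP.
have mQ n : measurable_fun setT (Q n) by apply: measurable_sum.
have Q0 n w : 0 <= Q n w by apply: sumr_ge0 => i _; exact: sqr_ge0.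
have EQ n : (0 < n)%N ->
    (\int[P]_w (Q n w)%:E <= ((t / n%:R) `^ (2 * H - 1))%:E)%E.
  move=> n0; have nR0 : 0 < n%:R :> R by rewrite ltr0n.
  have tn0 : 0 <= t / n%:R by rewrite divr_ge0// ltW.
  have pI i : (i <= n)%N -> p n i \in `[0, 1].
    move=> ni; rewrite in_itv/= /p divr_ge0 ?mulr_ge0 ?ler0n ?(ltW t0)//=.
    rewrite ler_pdivrMr// mul1r (@le_trans _ _ (1 * i%:R))// ?ler_wpM2r//.
    by rewrite mul1r ler_nat.
  under eq_integral do rewrite /Q -sumEFin.
  rewrite ge0_integral_sum//; last 2 first.
  - by move=> i; apply/measurable_EFinP.
  - by move=> i w _; rewrite lee_fin sqr_ge0.
  have -> : (\sum_(0 <= i < n)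
      \int[P]_w ((B (p n i.+1) w - B (p n i) w) ^+ 2)%:E =
      \sum_(0 <= i < n) ((t / n%:R) `^ (2 * H))%:E)%E.
    rewrite big_nat_cond [RHS]big_nat_cond; apply: eq_bigr => i.
    rewrite andbT => /andP[_ ni]; rewrite (fbm_incr_sqr B_fbm H_gt) ?pI// 1?ltnW//.
    have -> : p n i.+1 - p n i = t / n%:R.
      by rewrite /p -mulrBl -mulrBr -natrB// subSnn mulr1.
    by rewrite ger0_norm.
  rewrite sumEFin lee_fin sumr_const_nat subn0 -(mulr_natr (_ `^ _)).
  rewrite -(mulr_powRB1 tn0) ?(lt_trans ltr01)//.
  rewrite mulrAC divfK ?gt_eqF// ler_piMl// powR_ge0//.
(* Countably many thresholds, so that the null sets can be united. *)
have QA (m : nat) : {ae P, forall w, forall N, exists2 n, (N < n)%N &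
    ~ (m.+1%:R^-1 <= Q n w)}.
  apply: (@ae_frequently_notin _ _ _ P (fun n => [set w | m.+1%:R^-1 <= Q n w])).
    move=> n; have := mQ n measurableT `[m.+1%:R^-1, +oo[%classic.
    rewrite setTI => /(_ (measurable_itv _)); congr measurable.
    by apply/seteqP; split=> w /=; rewrite in_itv/= andbT.
  move=> e e0 N.
  have p0 : 0 < 2 * H - 1 by rewrite subr_gt0.
  have em0 : 0 < e / m.+1%:R by rewrite divr_gt0.
  have [delta d0 dP] := small_powR p0 em0.
  pose n := (maxn N (Num.bound (t / delta))).+1.
  exists n; first by rewrite ltnS leq_maxl.
  have nR0 : 0 < n%:R :> R by rewrite ltr0n.
  have m0 : 0 < m.+1%:R^-1 :> R by rewrite invr_gt0.
  apply: le_trans (markov_ge0 (mQ n) (Q0 n) m0) _.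
  rewrite invrK; apply: (@le_trans _ _ (m.+1%:R%:E * (e / m.+1%:R)%:E)%E).
    rewrite lee_wpmul2l ?lee_fin//; apply: le_trans (EQ n isT) _.
    rewrite lee_fin; apply: dP; first by rewrite divr_ge0// ltW.
    rewrite ler_pdivrMr// mulrC -ler_pdivrMr//.
    apply: ltW; apply: lt_le_trans (archi_boundP (divr_ge0 (ltW t0) (ltW d0))) _.
    by rewrite ler_nat /n leqW// leq_maxr.
  by rewrite -EFinM mulrC divfK.
have /ae_foralln : forall m : nat, {ae P, forall w, forall N,
  exists2 n, (N < n)%N & ~ (m.+1%:R^-1 <= Q n w)} by [].
apply: filterS => w /= Qw e N e0.
have [n Nn /negP] := Qw (Num.bound e^-1) N; rewrite -ltNge => Qn.
exists n => //; apply: lt_trans Qn _.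
rewrite invf_plt ?posrE//; apply: lt_trans (archi_boundP _) _.
  by rewrite invr_ge0 ltW.
by rewrite ltr_nat.
Qed.

(** The increment over a time [u] has standard deviation [u ^ H], so it is bounded by [m * u] with
    probability at most [8 * m * u ^ (1 - H)], which tends to 0 with [u]. *)
Lemma fbm_not_lipschitz t : H < 1 -> 0 <= t -> t < 1 ->
  {ae P, forall w, forall C r : R, 0 < r -> exists u,
    [/\ 0 < u, u < r, t + u <= 1 & C * u < `|B (t + u) w - B t w|]}.
Proof.
move=> H1 t0 t1; pose u k : R := (1 - t) / k.+1%:R.
have t10 : 0 < 1 - t by rewrite subr_gt0.
have u0 k : 0 < u k by rewrite divr_gt0.
have u1 k : t + u k <= 1.
  by rewrite -lerBrDl ler_pdivrMr// ler_peMr ?(ltW t10)// ler1n.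
have tI : t \in `[0, 1] by rewrite in_itv/= t0 ltW.
have tuI k : t + u k \in `[0, 1] by rewrite in_itv/= u1 andbT addr_ge0// ltW.
pose D k : {RV P >-> R} := (B (t + u k) \- B t)%R.
have Dv k : 'V_P[D k]%E = (u k `^ (2 * H))%:E.
  by rewrite (fbm_incr_variance B_fbm H_gt)// addrAC subrr add0r gtr0_norm.
have QA (m : nat) : {ae P, forall w, forall N, exists2 k, (N < k)%N &
    ~ (`|D k w| <= m%:R * u k)}.
  apply: (@ae_frequently_notin _ _ _ P (fun k => [set w | `|D k w| <= m%:R * u k])).
    move=> k; have mD : measurable_fun setT (D k) by exact: measurable_funP.
    have := mD measurableT `[- (m%:R * u k), m%:R * u k]%classic.
    rewrite setTI => /(_ (measurable_itv _)); congr measurable.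
    by apply/seteqP; split=> w /=; rewrite in_itv/= ler_norml.
  move=> e e0 N.
  have p0 : 0 < 1 - H by rewrite subr_gt0.
  (* The added 1 keeps the denominator positive when [m = 0]. *)
  have em0 : 0 < e / (8 * m%:R + 1) by rewrite divr_gt0// ltr_wpDl// mulr_ge0.
  have [delta d0 dP] := small_powR p0 em0.
  pose k := (maxn N (Num.bound ((1 - t) / delta))).+1.
  exists k; first by rewrite ltnS leq_maxl.
  have uk0 := u0 k.
  apply: le_trans (gaussian_rv_small_ball (fbm_incr_gaussian B_fbm tI (tuI k))
    (fbm_incr_Lfun2 B_fbm H_gt tI (tuI k)) (Dv k) (powR_gt0 _ uk0) _) _.
    by rewrite mulr_ge0// ltW.
  rewrite lee_fin.
  have -> : Num.sqrt (u k `^ (2 * H)) = u k `^ H.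
    by rewrite mulrC powRrM powR_mulrn ?powR_ge0// sqrtr_sqr ger0_norm ?powR_ge0.
  have -> : 8 * (m%:R * u k) / u k `^ H = 8 * m%:R * u k `^ (1 - H).
    rewrite powRB; last by rewrite gt_eqF ?implybT.
    by rewrite powRr1 ?ltW//; ring.
  have /dP h : u k <= delta.
    rewrite ler_pdivrMr// mulrC -ler_pdivrMr//.
    apply: ltW; apply: lt_le_trans (archi_boundP (divr_ge0 (ltW t10) (ltW d0))) _.
    by rewrite ler_nat /k; apply/leqW/leqW; exact: leq_maxr.
  apply: (@le_trans _ _ (8 * m%:R * (e / (8 * m%:R + 1)))).
    by rewrite ler_wpM2l ?mulr_ge0// h// ltW.
  rewrite mulrA ler_pdivrMr; last by rewrite ltr_wpDl// mulr_ge0.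
  by rewrite mulrC ler_wpM2l ?ltW// ltrDl.
have /ae_foralln : forall m : nat, {ae P, forall w, forall N, exists2 k, (N < k)%N &
    ~ (`|D k w| <= m%:R * u k)} by [].
apply: filterS => w /= Qw C r r0.
have [k Nk /negP] := Qw (Num.bound `|C|) (Num.bound ((1 - t) / r)).
rewrite -ltNge => Dk; exists (u k); split => //.
- rewrite ltr_pdivrMr// mulrC -ltr_pdivrMr//.
  apply: lt_trans (archi_boundP (divr_ge0 (ltW t10) (ltW r0))) _.
  by rewrite ltr_nat; exact: ltnW.
- apply: le_lt_trans Dk; rewrite ler_wpM2r ?(ltW (u0 k))//.
  by apply: le_trans (ler_norm _) _; exact/ltW/archi_boundP.
Qed.

End paths.


(** * Solutions and their Lamperti transform *)

Section smooth_functions.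
Context {R : realType}.
Implicit Types (f g : R -> R).

Lemma class_C_is_derive k g j : class_C k g -> (j < k)%N ->
  forall x, is_derive x (1 : R) (derive1n j g) (derive1n j.+1 g x).
Proof.
move=> [dg _] jk x; apply: DeriveDef; first exact: dg.
by rewrite -derive1E /derive1n iterS.
Qed.

Lemma bounded_fun_le f : bounded_fun f -> exists M, forall x, `|f x| <= M.
Proof.
move=> [M [_ fM]]; exists (M + 1) => x.
by apply: (fM (M + 1)) => //; rewrite ltrDl.
Qed.

Lemma lipschitz_is_derive f df M : (forall x, is_derive x (1 : R) f (df x)) ->
  (forall x, `|df x| <= M) -> forall x y, `|f x - f y| <= M * `|x - y|.
Proof.
move=> fdf dfM x y; wlog yx : x y / y <= x.
  move=> h; have [yx|/ltW xy] := leP y x; first exact: h.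
  by rewrite distrC [`|x - y|]distrC; exact: h.
have [c _ ->] := MVT_is_derive fdf yx.
by rewrite normrM ler_wpM2r.
Qed.

(** Boundedness guarantees that [inf] is a genuine lower bound and not a default value. *)
Lemma inf_range_le f x : bounded_fun f -> inf (range f) <= f x.
Proof.
move=> /bounded_fun_le[M fM]; apply: ge_inf; last by exists x.
by exists (- M) => _ [y _ <-]; have := fM y; rewrite ler_norml => /andP[].
Qed.

Lemma inv_lipschitz f c M : 0 < c -> (forall x, c <= f x) ->
  (forall x y, `|f x - f y| <= M * `|x - y|) ->
  forall x y, `|(f x)^-1 - (f y)^-1| <= M / c ^+ 2 * `|x - y|.
Proof.
move=> c0 cf fM x y; have fx := cf x; have fy := cf y.
have fx0 : 0 < f x by exact: lt_le_trans fx.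
have fy0 : 0 < f y by exact: lt_le_trans fy.
have -> : (f x)^-1 - (f y)^-1 = (f y - f x) / (f x * f y).
  by field; rewrite !gt_eqF.
rewrite normrM normfV (ger0_norm (ltW (mulr_gt0 fx0 fy0))) distrC.
have inv_le : (f x * f y)^-1 <= (c ^+ 2)^-1.
  rewrite lef_pV2 ?posrE ?mulr_gt0 ?exprn_gt0// expr2.
  by apply: ler_pM => //; exact: ltW.
rewrite mulrAC; apply: ler_pM => //.
by rewrite invr_ge0 ltW// mulr_gt0.
Qed.

End smooth_functions.

(** * The Lamperti identity along one fixed path *)

Section pathwise.
Context {R : realType}.

Lemma tagged_sum_le (g h : R -> R) (delta a b v : R) :
  tagged_sum g h delta a b v -> a <= b.
Proof.
by elim=> [//|x y z xi u xy _ _ _]; apply: le_trans; exact: ltW.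
Qed.

Lemma eq_tagged_sum (g g' h : R -> R) (delta a b v : R) :
  (forall s, a <= s <= b -> g s = g' s) ->
  tagged_sum g h delta a b v -> tagged_sum g' h delta a b v.
Proof.
move=> gg' ts; elim: ts gg' => [x|x y z xi u xy yd /andP[xxi xiy] ts IH] gg'.
  exact: tagged_sum_nil.
have yz := tagged_sum_le ts.
rewrite gg' ?xxi ?(le_trans xiy)//; apply: tagged_sum_cons; rewrite ?xxi//.
by apply: IH => s /andP[ys sz]; apply: gg'; rewrite sz (le_trans (ltW xy)).
Qed.

(** Passes from countably many times, where null sets can be united, to all times. *)
Lemma continuous_eq0_rat (D : R -> R) : continuous D ->
  (forall q : rat, 0 < ratr q :> R -> ratr q <= 1 :> R -> D (ratr q) = 0) ->
  forall t, 0 <= t <= 1 -> D t = 0.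
Proof.
move=> cD Dq t /andP[t0 t1]; apply/eqP; rewrite -normr_le0.
apply/ler_addgt0Pl => e e0; rewrite addr0.
have /cvgrPdist_lt/(_ _ e0)/nbhs_ballP[r /= r0 rP] := cD t.
have : Num.max 0 (t - r) < Num.min 1 (t + r).
  by rewrite gt_max !lt_min ltr01/=; apply/and3P; split; lra.
move=> /rat_in_itvoo[q]; rewrite in_itv/= gt_max lt_min => /andP[/andP[q0 q1] /andP[q2 q3]].
have : ball t r (ratr q) by rewrite /ball/= ltr_norml; apply/andP; split; lra.
by move=> /rP; rewrite Dq ?(ltW q2)// subr0 => /ltW.
Qed.

Lemma solution_path (a sigma ell Lam x b : R -> R) (x0 K L M : R) :
  continuous a -> continuous sigma -> continuous ell ->
  {within `[0, 1], continuous x} -> {within `[0, 1], continuous b} ->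
  (forall y, `|a y| <= M) -> (forall y, `|sigma y| <= M) ->
  (forall y, `|ell y| <= L) ->
  (forall y z, `|ell y - ell z| <= K * `|y - z|) ->
  (forall y, ell y * sigma y = 1) ->
  (forall y, is_derive y (1 : R) Lam (ell y)) ->
  (forall t : R, t \in `[0, 1] -> exists2 I : R,
      is_RS_integral (fun s => sigma (x s)) b 0 t I &
      x t = x0 + \int[lebesgue_measure]_(s in `[0, t]) a (x s) + I) ->
  (forall q : rat, 0 < ratr q :> R -> ratr q <= 1 :> R ->
    forall (e : R) N, 0 < e -> exists2 n, (N < n)%N &
    \sum_(0 <= i < n) (b (ratr q * i.+1%:R / n%:R)
                         - b (ratr q * i%:R / n%:R)) ^+ 2 < e) ->
  exists G : R -> R,
    (forall t, is_derive t (1 : R) G (ell (x (clamp t)) * a (x (clamp t)))) /\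
    forall t, 0 <= t <= 1 -> Lam (x t) = Lam x0 + (b t - b 0) + (G t - G 0).
Proof.
move=> ca csigma cell cx cb aM sM lL lK ls dLam sol QV.
pose X := x \o clamp.
have cX : continuous X := continuous_clamp cx.
have caX : continuous (a \o X).
  by move=> t; apply: continuous_comp; [exact: cX|exact: ca].
have clX : continuous (ell \o X).
  by move=> t; apply: continuous_comp; [exact: cX|exact: cell].
have [A dA] := exists_primitive caX.
have cG : continuous (fun t => ell (X t) * a (X t)).
  by move=> t; apply: cvgM; [exact: clX|exact: caX].
have [G dG] := exists_primitive cG.
exists G; split=> //.
(* The integral as a function of time, with junk values outside [[0, 1]]. *)
have /choice[I IP] : forall t, exists I : R, 0 <= t <= 1 ->
    is_RS_integral (fun s => sigma (x s)) b 0 t I /\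
    x t = x0 + \int[lebesgue_measure]_(s in `[0, t]) a (x s) + I.
  move=> t; have [tI|_] := boolP (0 <= t <= 1); last by exists 0.
  have tI' : t \in `[0, 1] by rewrite in_itv.
  by have [I ? ?] := sol _ tI'; exists I.
have Xid t : 0 <= t <= 1 -> X t = x t by move=> tI; rewrite /X/= clamp_id.
have RS t : 0 <= t <= 1 -> forall e : R, 0 < e ->
    exists2 delta : R, 0 < delta &
    forall v, tagged_sum (sigma \o X) b delta 0 t v -> `|v - I t| < e.
  move=> tI e e0; have [+ _] := IP _ tI.
  move=> /is_RS_integral_tagged_sum/(_ _ e0)[delta d0 H].
  exists delta => // v ts; apply: H; apply: eq_tagged_sum ts => s /andP[s0 st].
  by rewrite /= -/(X s) Xid// s0 (le_trans st)//; case/andP: tI.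
(* The empty sum is a fine sum over [[0, 0]]. *)
have I0 : I 0 = 0.
  apply/eqP; rewrite -normr_le0; apply/ler_addgt0Pl => e e0; rewrite addr0.
  have [|delta d0 /(_ 0 (tagged_sum_nil _ _ _ _))] := RS 0 _ _ e0.
    by rewrite lexx ler01.
  by rewrite sub0r normrN => /ltW.
have xA t : 0 <= t <= 1 -> x t = x0 + (A t - A 0) + I t.
  move=> /[dup] tI /andP[t0 t1]; have [_ ->] := IP _ tI.
  rewrite -(Rintegral_is_derive caX dA t0); congr (_ + _ + _).
  apply: eq_Rintegral => s; rewrite inE/= in_itv/= => /andP[s0 st].
  by rewrite -/(X s) Xid// s0 (le_trans st).
have I01 : 0 <= (0 : R) <= 1 by rewrite lexx ler01.
have X0 : X 0 = x0 by rewrite Xid// xA// I0 subrr !addr0.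
have cbc := continuous_clamp cb.
pose D t := Lam (X t) - Lam x0 - (b (clamp t) - b 0) - (G t - G 0).
suff D0 t : 0 <= t <= 1 -> D t = 0.
  move=> t tI; have := D0 _ tI; rewrite /D Xid// clamp_id//; lra.
apply: continuous_eq0_rat => [{}t|q q0 q1].
  have cLam := is_derive_continuous dLam.
  have cGp := is_derive_continuous dG.
  apply: cvgB; last by apply: cvgB; [exact: cGp|exact: cvg_cst].
  apply: cvgB; last by apply: cvgB; [exact: cbc|exact: cvg_cst].
  apply: cvgB; last exact: cvg_cst.
  by apply: (@continuous_comp _ _ _ X Lam); [exact: cX|exact: cLam].
have qI : 0 <= (ratr q : R) <= 1 by rewrite (ltW q0).
have := @RS_chain_rule _ X b (a \o X) A G Lam ell (sigma \o X) I (ratr q) K L M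
  (ltW q0) cX dA dG dLam (fun t => aM _) (fun t => sM _) lL lK (fun t => ls _).
move=> /(_ _ _ (QV _ q0 q1)) H; rewrite /D clamp_id//.
have -> : Lam (X (ratr q)) - Lam x0 = b (ratr q) - b 0 + (G (ratr q) - G 0).
  rewrite -X0; apply: H.
  - by move=> u /andP[u0 uq]; apply: RS; rewrite u0 (le_trans uq).
  - by move=> u /andP[u0 uq]; rewrite X0 Xid ?xA// u0 (le_trans uq).
by ring.
Qed.

End pathwise.


(** * Functions with derivative bounded below by a positive constant, and their inverses *)

Section increasing_primitive.
Context {R : realType} (F f : R -> R) (m : R).
Context (dF : forall x, is_derive x (1 : R) F (f x)) (m0 : 0 < m)
  (mf : forall x, m <= f x).

Lemma derive_ge_growth (x y : R) : x <= y -> m * (y - x) <= F y - F x.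
Proof.
move=> xy; have [c _ ->] := MVT_is_derive dF xy.
by rewrite ler_wpM2r// subr_ge0.
Qed.

Lemma derive_gt0_inj : injective F.
Proof.
move=> x y; wlog xy : x y / x <= y => [h|Fxy].
  by have [/h|/ltW/h h' /esym/h'] := leP x y.
apply/eqP; rewrite eq_le xy/= -subr_le0 -(pmulr_rle0 _ m0).
by have := derive_ge_growth xy; rewrite Fxy subrr.
Qed.

Lemma derive_gt0_surj (y : R) : exists x, F x = y.
Proof.
(* Over the distance [r] the function grows by at least [|y - F 0|]. *)
pose r := `|y - F 0| / m.
have r0 : 0 <= r by rewrite divr_ge0// ltW.
have mr : m * r = `|y - F 0| by rewrite /r mulrC divfK// gt_eqF.
have h1 : F 0 + `|y - F 0| <= F r.
  by have := derive_ge_growth r0; rewrite subr0 mr; lra.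
have h2 : F (- r) <= F 0 - `|y - F 0|.
  have rN : - r <= 0 by lra.
  by have := derive_ge_growth rN; rewrite sub0r opprK mr; lra.
have [|||c _ Fc] := @IVT _ F (- r) r y; last by exists c.
- lra.
- by apply: continuous_subspaceT; exact: is_derive_continuous dF.
- have := ler_norm (y - F 0); have := ler_norm (- (y - F 0)); rewrite normrN.
  move=> h3 h4; rewrite ge_min le_max; apply/andP; split; apply/orP.
    by left; lra.
  by right; lra.
Qed.

Lemma derive_gt0_inverse : exists g : R -> R,
  [/\ cancel F g, cancel g F &
      forall y, is_derive y (1 : R) g (f (g y))^-1].
Proof.
have [g gK] := choice derive_gt0_surj.
have Fg : cancel F g by move=> x; apply: derive_gt0_inj; rewrite gK.
exists g; split=> // y; rewrite -{1}(gK y).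
apply: (@is_derive_inverse _ F g (f (g y)) (g y)).
- by near=> z; exact: Fg.
- by near=> z; exact: is_derive_continuous dF z.
- by rewrite gt_eqF// (lt_le_trans m0).
Unshelve. all: by end_near. Qed.

End increasing_primitive.

(** * Regularity on the strip of functions of [C + kappa * t + x] *)

Section strip.
Context {R : realType}.

Lemma is_derive_slope (h : R -> R) (t l : R) (A : set R) :
  is_derive t (1 : R) h l ->
  (h s - h t) / (s - t) @[s --> within A t^'] --> l.
Proof.
move=> /is_derive1_caratheodory[g [gE cg <-]].
apply: (@cvg_trans _ (g s @[s --> within A t^'])).
  apply: near_eq_cvg; near=> s.
  rewrite gE mulfK// subr_eq0.
  near: s; rewrite near_withinE; near=> s => _.
  by near: s; exact: nbhs_dnbhs_neq.
apply: cvg_within_filter; apply: cvg_within_filter; exact: cg.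
Unshelve. all: by end_near. Qed.

Lemma continuous_affine (g : R -> R) (c C kappa : R) : continuous g ->
  continuous (fun p : R * R => c * g (C + kappa * p.1 + p.2)).
Proof.
move=> cg p; apply: cvgM; first exact: cvg_cst.
apply: (@continuous_comp _ _ _ (fun p : R * R => C + kappa * p.1 + p.2) g).
  apply: cvgD; last exact: cvg_snd.
  by apply: cvgD; [exact: cvg_cst|apply: cvgM; [exact: cvg_cst|exact: cvg_fst]].
exact: cg.
Qed.

(** [g] lists a function and its successive derivatives. The factor [c] makes the induction go
    through: differentiating in time shifts [g] and multiplies [c] by [kappa]. *)
Lemma class_C_strip_affine (k : nat) (g : nat -> R -> R) (c C kappa : R) :
  (forall j, (j < k)%N -> forall y, is_derive y (1 : R) (g j) (g j.+1 y)) ->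
  continuous (g k) ->
  class_C_strip k (fun p : R * R => c * g 0%N (C + kappa * p.1 + p.2)).
Proof.
elim: k g c => [|k IH] g c dg cg.
  by split=> //; apply/continuous_subspaceT/continuous_affine.
split.
  apply/continuous_subspaceT/continuous_affine.
  exact: is_derive_continuous (dg 0%N isT).
exists (fun p => (c * kappa) * g 1%N (C + kappa * p.1 + p.2)),
  (fun p => c * g 1%N (C + kappa * p.1 + p.2)); split.
- move=> t x _ /=.
  apply: (@is_derive_slope (fun s => c * g 0%N (C + kappa * s + x))).
  have dlin : is_derive t (1 : R) (fun s => C + kappa * s + x) kappa.
    apply: is_derive_eq; rewrite /GRing.scale/=; ring.
  have := @is_derive1_comp _ (g 0%N) _ t _ _ (dg 0%N isT _) dlin.
  move=> dcomp; apply: (@is_derive_eq _ _ _ _ _ _ _ _ (is_deriveZ c dcomp)).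
  by rewrite /GRing.scale/=; ring.
- move=> t x _ /=.
  have dlin : is_derive x (1 : R) (fun y => C + kappa * t + y) 1.
    apply: is_derive_eq; rewrite /GRing.scale/=; ring.
  have := @is_derive1_comp _ (g 0%N) _ x _ _ (dg 0%N isT _) dlin.
  move=> dcomp; apply: (@is_derive_eq _ _ _ _ _ _ _ _ (is_deriveZ c dcomp)).
  by rewrite /GRing.scale/= mulr1.
- by apply: (IH (fun j => g j.+1)) => // j jk; exact: dg.
- by apply: (IH (fun j => g j.+1)) => // j jk; exact: dg.
Qed.

End strip.


(** * The Lamperti identity almost surely, and the case of proportional coefficients *)

Section lamperti.
Context {R : realType} d (T : measurableType d) (P : probability T R).
Context (H : R) (B : R -> {RV P >-> R}) (B_fbm : fractional_brownian_motion H B).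
Context (H_gt : 1 < 2 * H).
Context (x0 : R) (a sigma sigma' Lam : R -> R) (c M : R).
Context (ca : continuous a)
  (dsigma : forall y, is_derive y (1 : R) sigma (sigma' y))
  (aM : forall y, `|a y| <= M) (sM : forall y, `|sigma y| <= M)
  (s'M : forall y, `|sigma' y| <= M)
  (c0 : 0 < c) (cs : forall y, c <= sigma y)
  (dLam : forall y, is_derive y (1 : R) Lam (sigma y)^-1).
Context (X : R -> {RV P >-> R}) (X_sol : is_solution B x0 a sigma X).

Let s0 y : 0 < sigma y. Proof. exact: lt_le_trans (cs y). Qed.

Lemma ae_forall_rat (Q : rat -> T -> Prop) :
  (forall q, {ae P, forall w, Q q w}) -> {ae P, forall w, forall q, Q q w}.
Proof.
move=> Qq; have : forall n : nat, {ae P, forall w,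
    forall q : rat, unpickle n = Some q -> Q q w}.
  move=> n; case: (unpickle n : option rat) => [q|]; last by apply: aeW.
  by apply: filterS (Qq q) => w Qw _ [<-].
by move=> /ae_foralln; apply: filterS => w /= Qw q; exact: Qw (pickleK q).
Qed.

(** The drift appears through a primitive [G], so that it can later be differentiated at a given
    time and estimated by the mean value theorem. *)
Lemma lamperti : {ae P, forall w,
  {within `[0, 1], continuous (fun t : R => X t w)} /\
  exists G : R -> R,
    (forall t, is_derive t (1 : R) G
       ((sigma (X (clamp t) w))^-1 * a (X (clamp t) w))) /\
    forall t, 0 <= t <= 1 -> Lam (X t w) = Lam x0 + (B t w - B 0 w) + (G t - G 0)}.
Proof.
have QV : {ae P, forall w, forall q : rat, 0 < (ratr q : R) ->
    (ratr q : R) <= 1 ->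
    forall (e : R) N, 0 < e -> exists2 n, (N < n)%N &
    \sum_(0 <= i < n) (B (ratr q * i.+1%:R / n%:R) w
                         - B (ratr q * i%:R / n%:R) w) ^+ 2 < e}.
  apply: ae_forall_rat => q; have [q0|q0] := ltP 0 (ratr q : R); last first.
    by apply: aeW => w.
  have [q1|q1] := leP (ratr q : R) 1; last by apply: aeW => w.
  by apply: filterS (fbm_quadratic_variation B_fbm H_gt q0 q1) => w.
apply: filterS2 X_sol QV => w [cX solw] QVw; split=> //.
have [_ _ _ /(_ w) cB] := B_fbm.
have cs' := is_derive_continuous dsigma.
have cell : continuous (fun y => (sigma y)^-1).
  by move=> y; apply: continuousV; [rewrite gt_eqF|exact: cs'].
have slip := lipschitz_is_derive dsigma s'M.
have ellL y : `|(sigma y)^-1| <= c^-1.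
  by rewrite gtr0_norm ?invr_gt0// lef_pV2 ?posrE.
have ls y : (sigma y)^-1 * sigma y = 1 by rewrite mulVf// gt_eqF.
exact: (solution_path ca cs' cell cX cB aM sM ellL (inv_lipschitz c0 cs slip)
  ls dLam solw QVw).
Qed.

Let Lam_growth : exists m : R, 0 < m /\ forall y, m <= (sigma y)^-1.
Proof.
have M0 : 0 < M by apply: lt_le_trans (sM 0); rewrite normr_gt0 gt_eqF.
exists M^-1; split=> [|y]; first by rewrite invr_gt0.
by rewrite lef_pV2 ?posrE//; exact: le_trans (ler_norm _) (sM y).
Qed.

Lemma proportional_solution (sigma'' : R -> R) (kappa : R) :
  (forall y, is_derive y (1 : R) sigma' (sigma'' y)) -> continuous sigma'' ->
  (forall y, a y = kappa * sigma y) ->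
  exists f : R * R -> R, class_C_strip 2 f /\
     {ae P, forall w, forall t : R, t \in `[0, 1] -> X t w = f (t, B t w)}.
Proof.
move=> dsigma' csigma'' ak.
have [m [m0 mell]] := Lam_growth.
have [F [LK FK dF]] := derive_gt0_inverse dLam m0 mell.
exists (fun p => 1 * F (Lam x0 + kappa * p.1 + p.2)); split.
  (* [F] is the inverse of [Lam], hence [F' = sigma (F)] and [F'' = sigma' (F) * sigma (F)]. *)
  pose g j := match j with 0%N => F | 1%N => sigma \o F
    | _ => fun y => sigma' (F y) * sigma (F y) end.
  have dF' y : is_derive y (1 : R) F (sigma (F y)).
    by have := dF y; rewrite invrK.
  have dsF y : is_derive y (1 : R) (sigma \o F) (sigma' (F y) * sigma (F y)).
    exact: is_derive1_comp (dsigma (F y)) (dF' y).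
  apply: (@class_C_strip_affine _ 2 g) => [[|[|//]] _ y/=|] //.
  have cF := is_derive_continuous dF.
  have cs1 := is_derive_continuous dsigma.
  have cs2 := is_derive_continuous dsigma'.
  move=> y; apply: cvgM.
    by apply: (@continuous_comp _ _ _ F sigma'); [exact: cF|exact: cs2].
  by apply: (@continuous_comp _ _ _ F sigma); [exact: cF|exact: cs1].
apply: filterS2 lamperti (fbm_start B_fbm H_gt) => w [_ [G [dG XG]]] B0 t.
rewrite in_itv/= => tI; rewrite mul1r/=; apply: (can_inj LK); rewrite FK XG// B0 subr0.
have -> : G t - G 0 = kappa * t.
  have [t0 _] := andP tI; have [s _ ->] := MVT_is_derive dG t0.
  by rewrite ak mulrCA mulVf ?mulr1 ?subr0// gt_eqF.
by ring.
Qed.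

End lamperti.


(** * From a representation [X t = f (t, B t)] to proportional coefficients *)

Section representation.
Context {R : realType} d (T : measurableType d) (P : probability T R).
Context (H : R) (B : R -> {RV P >-> R}) (B_fbm : fractional_brownian_motion H B).
Context (H_gt : 1 < 2 * H) (H_lt : H < 1).
Context (x0 : R) (a sigma sigma' Lam : R -> R) (c M : R).
Context (ca : continuous a)
  (dsigma : forall y, is_derive y (1 : R) sigma (sigma' y))
  (aM : forall y, `|a y| <= M) (sM : forall y, `|sigma y| <= M)
  (s'M : forall y, `|sigma' y| <= M)
  (c0 : 0 < c) (cs : forall y, c <= sigma y)
  (dLam : forall y, is_derive y (1 : R) Lam (sigma y)^-1).
Context (X : R -> {RV P >-> R}) (X_sol : is_solution B x0 a sigma X).
Context (f ft fx : R * R -> R)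
  (cf : {within `[0, 1]%classic `*` setT, continuous f})
  (cfx : {within `[0, 1]%classic `*` setT, continuous fx})
  (dft : forall t x : R, t \in `[0, 1] ->
    (f (s, x) - f (t, x)) / (s - t) @[s --> within `[0, 1] t^'] --> ft (t, x))
  (dfx : forall t x : R, t \in `[0, 1] ->
    is_derive x (1 : R) (fun y : R => f (t, y)) (fx (t, x)))
  (Xf : {ae P, forall w, forall t : R, t \in `[0, 1] -> X t w = f (t, B t w)}).

Let s0 y : 0 < sigma y. Proof. exact: lt_le_trans (cs y). Qed.

Let phi t y := Lam (f (t, y)) - y.
Let phix (p : R * R) := (sigma (f p))^-1 * fx p - 1.

Let is_derive_phi t y : t \in `[0, 1] ->
  is_derive y (1 : R) (phi t) (phix (t, y)).
Proof.
move=> tI; apply: is_deriveB.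
exact: (@is_derive1_comp _ Lam (fun z => f (t, z)) y _ _ (dLam _) (dfx y tI)).
Qed.

Let ell_lipschitz y z : `|Lam y - Lam z| <= c^-1 * `|y - z|.
Proof.
apply: (lipschitz_is_derive dLam) => u.
by rewrite gtr0_norm ?invr_gt0// lef_pV2 ?posrE.
Qed.

Let phix_near t y e : 0 < t < 1 -> 0 < e ->
  exists2 r : R, 0 < r & forall s z, s \in `[0, 1] -> `|t - s| < r ->
    `|y - z| < r -> `|phix (t, y) - phix (s, z)| < e.
Proof.
move=> /andP[t0 t1] e0.
have tyS : (`[0, 1]%classic `*` setT) (t, y).
  by split=> //=; rewrite in_itv/= !ltW.
have cs' := is_derive_continuous dsigma.
have c1 : phix p @[p --> within (`[0, 1]%classic `*` setT) (nbhs (t, y))]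
    --> phix (t, y).
  have /subspace_continuousP/(_ _ tyS) cft := cf.
  have /subspace_continuousP/(_ _ tyS) cfxt := cfx.
  apply: cvgB; last exact: cvg_cst.
  apply: cvgM; last exact: cfxt.
  apply: cvgV; first by rewrite gt_eqF.
  apply: (cvg_comp f sigma cft); exact: cs'.
have /cvgrPdist_lt/(_ _ e0)[[U V] /= [/nbhs_ballP[r1 /= r10 U1]
  /nbhs_ballP[r2 /= r20 V2]] UV] := c1.
exists (Num.min r1 r2); first by rewrite lt_min r10.
move=> s z sI; rewrite !lt_min => /andP[ts _] /andP[_ yz].
by apply: (UV (s, z)) => //=; split; [exact: U1|exact: V2].
Qed.

(** Differentiability in time at the single point [(t, y)] gives a Lipschitz bound centred at [t],
    with a constant depending on [y]. *)
Let modulus t y : 0 < t < 1 -> exists r C : R, 0 < r /\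
  forall s, s \in `[0, 1] -> `|s - t| < r ->
  `|phi s y - phi t y| <= C * `|s - t|.
Proof.
move=> /andP[t0 t1]; have tI : t \in `[0, 1] by rewrite in_itv/= !ltW.
have /cvgrPdist_lt/(_ _ ltr01) := @dft t y tI.
rewrite !near_withinE => /nbhs_ballP[r /= r0 rP].
exists r, (c^-1 * (`|ft (t, y)| + 1)); split=> // s sI st.
have -> : phi s y - phi t y = Lam (f (s, y)) - Lam (f (t, y)).
  by rewrite /phi; ring.
apply: le_trans (ell_lipschitz _ _) _.
rewrite -mulrA ler_wpM2l ?invr_ge0 ?(ltW c0)//.
have [->|nst] := eqVneq s t; first by rewrite !subrr normr0 mulr0.
have bts : ball t r s by rewrite /ball/= distrC.
have := rP s bts nst sI.
set q := _ / _ => fq.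
have -> : f (s, y) - f (t, y) = q * (s - t) by rewrite /q divfK// subr_eq0.
rewrite normrM ler_wpM2r//.
have := ler_normB (ft (t, y)) (ft (t, y) - q); rewrite subKr => h.
by apply: le_trans h _; rewrite lerD2l ltW.
Qed.

Let path_incr : {ae P, forall w, exists G : R -> R,
    (forall t, is_derive t (1 : R) G
       ((sigma (X (clamp t) w))^-1 * a (X (clamp t) w))) /\
    forall t, 0 <= t <= 1 -> phi t (B t w) = Lam x0 - B 0 w + (G t - G 0)}.
Proof.
have := lamperti B_fbm H_gt ca dsigma aM sM s'M c0 cs dLam X_sol.
apply: filterS2 Xf => w Xfw [_ [G [dG XG]]].
exists G; split=> // t tI.
by rewrite /phi -Xfw ?in_itv// XG//; ring.
Qed.

Let full_support t y r (Q : T -> Prop) : 0 < t < 1 -> 0 < r ->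
  {ae P, forall w, Q w} -> exists w, `|B t w - y| < r /\ Q w.
Proof.
move=> /andP[t0 t1] r0 Qw; have tI : t \in `[0, 1] by rewrite in_itv/= !ltW.
exact: (gaussian_rv_full_support y (fbm_gaussian B_fbm tI)
  (fbm_Lfun2 B_fbm H_gt tI) (fbm_variance B_fbm H_gt tI) (powR_gt0 _ t0) r0 Qw).
Qed.

(** Otherwise pick a path with [B t] near [y] that is not Lipschitz at [t]. Shortly after [t],
    [modulus] and the Lipschitz bound on [G] confine the change of [phi s] between [B t] and [B s]
    to a multiple of [s - t], while its slope there stays away from 0; this bounds the increment of
    [B] linearly. *)
Let phix_eq0 t y : 0 < t < 1 -> phix (t, y) = 0.
Proof.
move=> tt; have /andP[t0 t1] := tt.
have tI : t \in `[0, 1] by rewrite in_itv/= !ltW.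
apply/eqP; apply: contrapT => /negP; rewrite -normr_gt0 => p0.
have p20 : 0 < `|phix (t, y)| / 2 by rewrite divr_gt0.
have [r r0 rP] := phix_near y tt p20.
(* One half for the distance from [y] to [B t w], the other for the increment of the path. *)
have r20 : 0 < r / 2 by rewrite divr_gt0.
have : {ae P, forall w, (exists G : R -> R,
    (forall t, is_derive t (1 : R) G
       ((sigma (X (clamp t) w))^-1 * a (X (clamp t) w))) /\
    forall t, 0 <= t <= 1 -> phi t (B t w) = Lam x0 - B 0 w + (G t - G 0)) /\
  forall C r : R, 0 < r -> exists u,
    [/\ 0 < u, u < r, t + u <= 1 & C * u < `|B (t + u) w - B t w|]}.
  apply: filterS2 path_incr (fbm_not_lipschitz B_fbm H_gt H_lt (ltW t0) t1).
  by move=> w.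
move=> /(full_support y tt r20)[w [xy [[G [dG phiG]] nlip]]].
set x := B t w in xy.
(* [C] depends on the outcome through [x], which is why [fbm_not_lipschitz] quantifies over the
   constants inside the almost sure event. *)
have [r1 [C [r10 modx]]] := modulus x tt.
have [_ _ _ /(_ w)/subspace_continuousP/(_ t tI)] := B_fbm.
move=> /cvgrPdist_lt/(_ _ r20)[r2 /= r2gt0 r2P].
have GL : forall s, `|G s - G t| <= c^-1 * M * `|s - t|.
  move=> s; apply: (lipschitz_is_derive dG) => u.
  rewrite normrM ler_pM//.
  by rewrite gtr0_norm ?invr_gt0// lef_pV2 ?posrE.
pose p := `|phix (t, y)|.
(* Total change of [phi s], per unit of time, divided by the lower bound [p / 2] on its slope. *)
pose C' := (c^-1 * M + C) / (p / 2).
have [|u [u0 ur ut]] := nlip C' (Num.min r (Num.min r1 r2)).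
  by rewrite !lt_min r0 r10.
rewrite -/x ltNge => /negP; apply.
move: ur; rewrite !lt_min => /and3P[ur ur1 ur2].
pose s := t + u; have sI : s \in `[0, 1] by rewrite in_itv/= ut andbT addr_ge0 ?ltW.
have st : `|s - t| = u by rewrite /s addrAC subrr add0r gtr0_norm.
have xs : `|x - B s w| < r / 2.
  by apply: r2P => //=; rewrite distrC st.
rewrite -/s; set z := B s w in xs *.
have /[!st] h1 : `|phi s x - phi t x| <= C * `|s - t| by apply: modx; rewrite ?st.
have /[!st] h2 : `|phi s z - phi t x| <= c^-1 * M * `|s - t|.
  rewrite /z /x !phiG//.
  have -> : Lam x0 - B 0 w + (G s - G 0) - (Lam x0 - B 0 w + (G t - G 0)) =
    G s - G t by ring.
  exact: GL.
have dphi v : is_derive v (1 : R) (phi s) (phix (s, v)) by exact: is_derive_phi.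
have [xi [xi1 xi2]] := MVT_dist x z dphi.
have yxi : `|y - xi| < r.
  rewrite (splitr r) -(subrKA x) (le_lt_trans (ler_normD _ _))// ltrD//.
    by rewrite distrC.
  by rewrite distrC (le_lt_trans xi1)// distrC.
have pxi : p / 2 <= `|phix (s, xi)|.
  have : `|phix (t, y) - phix (s, xi)| < p / 2 by apply: rP => //; rewrite distrC st.
  have := ler_normD (phix (t, y) - phix (s, xi)) (phix (s, xi)).
  rewrite subrK -/p [in leLHS](splitr p) => h4 h5.
  by rewrite -(lerD2l (p / 2)); apply: le_trans h4 _; rewrite lerD2r ltW.
rewrite -/p in p20.
rewrite /C' mulrAC ler_pdivlMr//.
have h3 : `|phi s z - phi s x| <= (c^-1 * M + C) * u.
  rewrite -(subrKA (phi t x)) (le_trans (ler_normD _ _))//.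
  by rewrite mulrDl lerD// distrC.
apply: le_trans h3; rewrite xi2 normrM mulrC.
by rewrite ler_wpM2r.
Qed.

Let phi_cst t y z : 0 < t < 1 -> phi t y = phi t z.
Proof.
move=> tt; have /andP[t0 t1] := tt.
have tI : t \in `[0, 1] by rewrite in_itv/= !ltW.
apply: is_derive_0_is_cst => u; rewrite -(phix_eq0 u tt).
exact: is_derive_phi.
Qed.

Lemma representation_proportional : exists kappa, forall y, a y = kappa * sigma y.
Proof.
pose t : R := 2^-1.
have tt : 0 < t < 1 by rewrite /t; apply/andP; split; lra.
have /andP[t0 t1] := tt.
have tI : t \in `[0, 1] by rewrite in_itv/= !ltW.
pose b z := (sigma z)^-1 * a z.
pose kappa := 'D_1 (fun s => phi s 0) t.
have bkappa : {ae P, forall w, b (f (t, B t w)) = kappa}.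
  apply: filterS2 path_incr Xf => w [G [dG phiG]] Xfw.
  (* For [s] near [t] the argument 0 may be replaced by [B s w], where [phi] is a constant plus
     [G s]. *)
  have dq : is_derive t (1 : R) (fun s => phi s 0) (b (f (t, B t w))).
    apply: (@near_eq_is_derive _ _ _ (fun s => Lam x0 - B 0 w + (G s - G 0))).
      near=> s; have ss : 0 < s < 1.
        by apply/andP; split; near: s; [exact: lt_nbhsr|exact: lt_nbhsl].
      rewrite (phi_cst 0 (B s w) ss) phiG//.
      by case/andP: ss => *; rewrite !ltW.
    have -> : b (f (t, B t w)) = (sigma (X (clamp t) w))^-1 * a (X (clamp t) w).
      by rewrite clamp_id ?ltW// Xfw.
    have := is_deriveD (is_derive_cst (Lam x0 - B 0 w) t (1 : R))
      (is_deriveB (dG t) (is_derive_cst (G 0) t (1 : R))).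
    by rewrite subr0 add0r.
  by rewrite /kappa; have [_ ->] := dq.
exists kappa => z.
have inj : injective Lam.
  have M0 : 0 < M by apply: lt_le_trans (sM 0); rewrite normr_gt0 gt_eqF.
  have M10 : 0 < M^-1 by rewrite invr_gt0.
  apply: (derive_gt0_inj dLam M10) => y.
  by rewrite lef_pV2 ?posrE//; exact: le_trans (ler_norm _) (sM y).
(* The solution of [Lam (f (t, y)) = Lam z], as [phi t] is constant. *)
pose y := Lam z - phi t 0.
have fz : f (t, y) = z.
  apply: inj; have := phi_cst y 0 tt; rewrite {1}/phi => h.
  by rewrite -[LHS](subrK y) h /y addrC subrK.
suff bz : b z = kappa by rewrite -bz /b mulrAC mulVf ?mul1r// gt_eqF.
rewrite -fz; apply/eqP; rewrite -subr_eq0 -normr_le0.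
apply/ler_addgt0Pl => e e0; rewrite addr0.
(* [b (f (t, v))] equals [kappa] at values [v] of [B t] arbitrarily close to [y], so continuity
   gives it at [y]. *)
have cb : {for y, continuous (fun v => b (f (t, v)))}.
  have cft : {for y, continuous (fun v => f (t, v))}.
    exact: (is_derive_continuous (fun v => dfx v tI)).
  apply: (@continuous_comp _ _ _ (fun v => f (t, v)) b) => //.
  apply: cvgM; last exact: ca.
  apply: cvgV; first by rewrite gt_eqF.
  exact: is_derive_continuous dsigma _.
have /cvgrPdist_lt/(_ _ e0)/nbhs_ballP[r /= r0 rP] := cb.
have [w [wy <-]] := full_support y tt r0 bkappa.
apply/ltW/rP; rewrite /ball/= distrC//.
Unshelve. all: by end_near. Qed.

End representation.

Theorem theorem1 (R : realType) (d : measure_display) (T : measurableType d)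
    (P : probability T R) (P_complete : measure_is_complete P)
    (H : R) (H_gt : 2^-1 < H) (H_lt : H < 1)
    (B : R -> {RV P >-> R}) (B_fbm : fractional_brownian_motion H B)
    (x0 : R) (a sigma : R -> R)
    (a_C2 : class_C 2 a) (a_der : bounded_derivatives 2 a)
    (a_bnd : bounded_fun a)
    (sigma_C3 : class_C 3 sigma) (sigma_der : bounded_derivatives 3 sigma)
    (sigma_bnd : bounded_fun sigma) (sigma_pos : 0 < inf (range sigma))
    (X : R -> {RV P >-> R}) (X_sol : is_solution B x0 a sigma X) :
  (exists f : R * R -> R, class_C_strip 2 f /\
     {ae P, forall w, forall t : R, t \in `[0, 1] -> X t w = f (t, B t w)})
  <->
  (forall x : R, derive1 a x * sigma x - a x * derive1 sigma x = 0).
Proof.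
have H2 : 1 < 2 * H by lra.
have da y : is_derive y (1 : R) a (derive1 a y) := class_C_is_derive (j := 0) a_C2 isT y.
have ds y : is_derive y (1 : R) sigma (derive1 sigma y) :=
  class_C_is_derive (j := 0) sigma_C3 isT y.
have ds1 y : is_derive y (1 : R) (derive1 sigma) (derive1n 2 sigma y) :=
  class_C_is_derive (j := 1) sigma_C3 isT y.
have cs2 : continuous (derive1n 2 sigma) :=
  is_derive_continuous (class_C_is_derive (j := 2) sigma_C3 isT).
have ca := is_derive_continuous da; have cs := is_derive_continuous ds.
have [Ma aM] := bounded_fun_le a_bnd.
have [Ms sM] := bounded_fun_le sigma_bnd.
have [Md dM] := bounded_fun_le (sigma_der 1%N isT).
pose M := Num.max Ma (Num.max Ms Md).
have aM' y : `|a y| <= M by rewrite /M !le_max aM.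
have sM' y : `|sigma y| <= M by rewrite /M !le_max sM orbT.
have dM' y : `|derive1 sigma y| <= M by rewrite /M !le_max (dM y) !orbT.
have sigma_ge y : inf (range sigma) <= sigma y := inf_range_le y sigma_bnd.
have s0 y : 0 < sigma y := lt_le_trans sigma_pos (sigma_ge y).
have [Lam dLam] : exists Lam, forall y, is_derive y (1 : R) Lam (sigma y)^-1.
  by apply: exists_primitive => y; apply: continuousV; [rewrite gt_eqF|exact: cs].
split=> [[f [[cf [ft [fx [dft dfx _ Cfx]]]] Xf]] x|asigma].
  have cfx : {within `[0, 1]%classic `*` setT, continuous fx} by case: Cfx.
  have [kappa ak] := representation_proportional B_fbm H2 H_lt ca ds aM' sM' dM'
    sigma_pos sigma_ge dLam X_sol cf cfx dft dfx Xf.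
  have -> : derive1 a x = kappa * derive1 sigma x.
    rewrite (_ : a = fun y => kappa * sigma y); last exact/funext.
    by rewrite derive1E (@derive_val _ _ _ _ _ _ _ (is_deriveZ kappa (ds x))).
  by rewrite ak; ring.
(* Its derivative is the vanishing expression divided by [sigma ^+ 2]. *)
pose q y := a y * (sigma y)^-1.
have dq y : is_derive y (1 : R) q 0.
  have sy0 : sigma y != 0 by rewrite gt_eqF.
  apply: (@is_derive_eq _ _ _ _ _ _ _ _ (is_deriveM (da y) (is_deriveV sy0 (ds y)))).
  rewrite /GRing.scale/=.
  apply: (mulIf (expf_neq0 2 sy0)); rewrite mul0r -(asigma y); field.
  by rewrite sy0.
have ak y : a y = q 0 * sigma y.
  by rewrite (is_derive_0_is_cst 0 y dq) /q divfK// gt_eqF.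
exact: (proportional_solution B_fbm H2 ca ds aM' sM' dM' sigma_pos sigma_ge dLam
  X_sol ds1 cs2 ak).
Qed.
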